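(* Let $\mathcal{P}\in\mathscr{P}_{\mathrm{disc}}\cup\mathscr{P}_{\mathrm{top}}$ and let $R$ be a ring satisfying $\mathcal{P}$. Then the center $\mathrm{Cent}(R)$ and any maximal commutative subring of $R$ satisfy $\mathcal{P}$.
   Context: All rings are unital; subrings share the unity. $\mathscr{P}_{\mathrm{disc}}$ is the set of properties: semiprimary; right perfect; left perfect; $\pi_\infty$-regular and semiperfect; $\pi_\infty$-regular; $\pi$-regular and semiperfect; $\pi$-regular. $\mathscr{P}_{\mathrm{top}}$ is the set of properties: pro-$\mathcal{Q}$, and pro-$\mathcal{Q}$ and semiperfect, for $\mathcal{Q}\in\mathscr{P}_{\mathrm{disc}}$; quasi-$\mathcal{Q}$, and quasi-$\mathcal{Q}$ and semiperfect, for $\mathcal{Q}\in\{\pi_\infty\text{-regular},\pi\text{-regular}\}$. A ring is said to satisfy a property in $\mathscr{P}_{\mathrm{top}}$ if it does so with respect to some linear ring topology (a ring topology having a local basis at $0$ of two-sided ideals). Definitions: $R$ is semilocal if $R/\mathrm{Jac}(R)$ is semisimple artinian; semiperfect if semilocal and idempotents lift modulo $\mathrm{Jac}(R)$; semiprimary if semilocal with $\mathrm{Jac}(R)$ nilpotent; right (left) perfect if semilocal and for every sequence $x_1,x_2,\dots\in\mathrm{Jac}(R)$ the sequence $x_1,x_2x_1,x_3x_2x_1,\dots$ (resp. $x_1,x_1x_2,x_1x_2x_3,\dots$) eventually vanishes. $R$ is $\pi$-regular if for every $a\in R$ the chain $aR\supseteq a^2R\supseteq\cdots$ stabilizes; $\pi_\infty$-regular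 if $\mathrm{M}_n(R)$ is $\pi$-regular for all $n$. A topological ring is pro-$\mathcal{Q}$ if it is isomorphic as a topological ring to the inverse limit of an inverse system (indexed by a directed set) of discrete rings satisfying $\mathcal{Q}$. A Hausdorff linearly topologized ring $R$ is quasi-$\pi$-regular if for every $a\in R$ there is an idempotent $e\in R$ such that, with $f:=1-e$: $a=eae+faf$; $eae$ is invertible in $eRe$; and $(faf)^n\to0$ as $n\to\infty$. It is quasi-$\pi_\infty$-regular if $\mathrm{M}_n(R)$, with local basis $\{\mathrm{M}_n(I): I \text{ an open ideal of } R\}$, is quasi-$\pi$-regular for all $n$. *)

(* Defs.v *)
From HB Require Import structures.
From mathcomp Require Import all_boot all_order all_algebra.
From mathcomp Require Import all_classical topology.

Set Implicit Arguments.
Unset Strict Implicit.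
Unset Printing Implicit Defensive.

Import Order.TTheory GRing.Theory.

Local Open Scope classical_set_scope.
Local Open Scope ring_scope.

(* A ring is a [pzRingType]: unital, not necessarily commutative, and the zero
   ring is allowed. *)

Section Ideals.
Variable R : pzRingType.
Implicit Types I M : set R.

Definition right_ideal I :=
  [/\ I 0, forall x y, I x -> I y -> I (x - y) & forall x r, I x -> I (x * r)].

Definition ideal I := right_ideal I /\ forall r x, I x -> I (r * x).

Definition maximal_right_ideal M :=
  [/\ right_ideal M, M != setT &
      forall I, right_ideal I -> M `<=` I -> I = M \/ I = setT].

Definition Jac : {pred R} :=
  fun x => `[< forall M, maximal_right_ideal M -> M x >].

Lemma JacP x : reflect (forall M, maximal_right_ideal M -> M x) (x \in Jac).
Proof. exact: asboolP. Qed.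

Lemma right_idealN I x : right_ideal I -> I x -> I (- x).
Proof. by case=> I0 IB _ Ix; rewrite -[- x]add0r; apply: IB. Qed.

Lemma right_idealD I x y : right_ideal I -> I x -> I y -> I (x + y).
Proof.
move=> rI Ix Iy; rewrite -[y]opprK; case: (rI) => _ IB _.
by apply: IB => //; apply: right_idealN.
Qed.

Lemma Jac_zmod_closed : zmod_closed Jac.
Proof.
split; first by apply/JacP => M [[]].
move=> x y /JacP xJ /JacP yJ; apply/JacP => M mM.
by case: (mM) => -[_ MB _] _ _; apply: MB; [apply: xJ | apply: yJ].
Qed.

HB.instance Definition _ := GRing.isZmodClosed.Build R Jac Jac_zmod_closed.

Lemma JacMr x r : x \in Jac -> x * r \in Jac.
Proof.
move=> /JacP xJ; apply/JacP => M mM.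
by case: (mM) => -[_ _ MM] _ _; apply: MM; apply: xJ.
Qed.

Lemma JacMl r x : x \in Jac -> r * x \in Jac.
Proof.
move=> /JacP xJ; apply/JacP => M mM.
case: (pselect (M r)) => [Mr|nMr]; first by case: (mM) => -[_ _ MM] _ _; apply: MM.
have rM : right_ideal M by case: mM.
suff : maximal_right_ideal [set s | M (r * s)] by move=> /xJ.
split.
- case: (rM) => M0 MB MM; split => /= [|s t Ms Mt|s t Ms].
  + by rewrite mulr0.
  + by rewrite mulrBr; apply: MB.
  + by rewrite mulrA; apply: MM.
- by apply/eqP => E; apply: nMr; have : [set: R] 1 by []; rewrite -E /= mulr1.
move=> I rI MI; case: (pselect (I `<=` [set s | M (r * s)])) => [IM|nIM].
  by left; apply/seteqP; split.
right; apply/seteqP; split => // s _.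
have [t It nMt] : exists2 t, I t & ~ M (r * t).
  by apply: contrapT => nt; apply: nIM => t It; apply: contrapT => nMt; apply: nt; exists t.
case: (mM) => _ _ /(_ [set m + r * u | m in M & u in I]) [].
- case: (rM) (rI) => M0 MB MM [I0 IB IM]; split => /=.
  + by exists 0 => //; exists 0 => //; rewrite mulr0 addr0.
  + move=> _ _ [m1 Mm1 [u1 Iu1 <-]] [m2 Mm2 [u2 Iu2 <-]].
    exists (m1 - m2); first exact: MB.
    exists (u1 - u2); first exact: IB.
    by rewrite mulrBr opprD addrACA.
  + move=> _ v [m Mm [u Iu <-]]; exists (m * v); first exact: MM.
    by exists (u * v); [exact: IM | rewrite mulrDl mulrA].
- move=> m Mm; exists m => //; exists 0; first by case: rI.
  by rewrite mulr0 addr0.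
- move=> E; case: nMt; rewrite -E; exists 0; first by case: rM.
  by exists t => //; rewrite add0r.
move=> E; have : [set: R] (r * s) by [].
rewrite -E => -[m Mm [u Iu ms]].
rewrite -[s](subrK u); apply: right_idealD => //; apply: MI => /=.
by rewrite mulrBr -ms addrK.
Qed.

End Ideals.

Arguments Jac R : clear implicits.

Definition quot_Jac (R : pzRingType) := Quotient.quot (Jac R).

Section QuotJac.
Local Open Scope quotient_scope.
Variable R : pzRingType.

Let pi (x : R) : quot_Jac R := \pi_(Quotient.quot (Jac R)) x.

HB.instance Definition _ := GRing.Zmodule.on (quot_Jac R).

Let one : quot_Jac R := pi 1.
Let mul (a b : quot_Jac R) : quot_Jac R := pi (repr a * repr b).

Let piK (a : quot_Jac R) : pi (repr a) = a.
Proof. exact: reprK. Qed.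

Let pi_eqP (x y : R) : (x - y \in Jac R) <-> (pi x = pi y).
Proof. by rewrite Quotient.idealrBE; split=> /eqP. Qed.

Let pi_mul (x y : R) : mul (pi x) (pi y) = pi (x * y).
Proof.
apply/pi_eqP; set x' := repr _; set y' := repr _.
have xJ : x' - x \in Jac R by apply/pi_eqP; rewrite piK.
have yJ : y' - y \in Jac R by apply/pi_eqP; rewrite piK.
have -> : x' * y' - x * y = (x' - x) * y' + x * (y' - y).
  by rewrite mulrBl mulrBr addrA subrK.
by apply: rpredD; [apply: JacMr | apply: JacMl].
Qed.

Let pi_add (x y : R) : pi x + pi y = pi (x + y).
Proof. by rewrite [RHS]Quotient.pi_add. Qed.

Let mulA : associative mul.
Proof.
move=> a b c; rewrite -[a]piK -[b]piK -[c]piK.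
by rewrite !pi_mul mulrA.
Qed.

Let mul1 : left_id one mul.
Proof. by move=> a; rewrite -[a]piK pi_mul mul1r. Qed.

Let mulr1' : right_id one mul.
Proof. by move=> a; rewrite -[a]piK pi_mul mulr1. Qed.

Let mulDl : left_distributive mul +%R.
Proof.
move=> a b c; rewrite -[a]piK -[b]piK -[c]piK.
by rewrite !(pi_add, pi_mul) mulrDl.
Qed.

Let mulDr : right_distributive mul +%R.
Proof.
move=> a b c; rewrite -[a]piK -[b]piK -[c]piK.
by rewrite !(pi_add, pi_mul) mulrDr.
Qed.

HB.instance Definition _ :=
  GRing.Zmodule_isPzRing.Build (quot_Jac R) mulA mul1 mulr1' mulDl mulDr.

End QuotJac.

Section DiscreteProperties.
Variable R : pzRingType.

Definition semisimple :=
  forall I : set R, right_ideal I -> exists K : set R,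
    [/\ right_ideal K, I `&` K = [set 0] &
        forall x, exists2 y, I y & exists2 z, K z & x = y + z].

Definition right_artinian :=
  forall I : nat -> set R, (forall n, right_ideal (I n)) ->
    (forall n, I n.+1 `<=` I n) ->
    exists n, forall m, (n <= m)%N -> I m = I n.

Definition pi_regular :=
  forall a : R, exists n, forall m, (n <= m)%N ->
    range (fun x => a ^+ m * x) = range (fun x => a ^+ n * x).

Definition idempotents_lift_mod_Jac :=
  forall x : R, x * x - x \in Jac R ->
    exists2 e : R, e * e = e & e - x \in Jac R.

(* [Jac R] is nilpotent iff all products of [n] of its elements vanish, for
   some [n]. *)
Definition Jac_nilpotent :=
  exists n, forall x : nat -> R, (forall i, x i \in Jac R) ->
    \prod_(i < n) x i = 0.

(* x_0, x_1 x_0, x_2 x_1 x_0, ... eventually vanishes *)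
Definition right_T_nilpotent_Jac :=
  forall x : nat -> R, (forall i, x i \in Jac R) ->
    exists N, forall n, (N <= n)%N -> \prod_(i < n.+1) x (n - i)%N = 0.

(* x_0, x_0 x_1, x_0 x_1 x_2, ... eventually vanishes *)
Definition left_T_nilpotent_Jac :=
  forall x : nat -> R, (forall i, x i \in Jac R) ->
    exists N, forall n, (N <= n)%N -> \prod_(i < n.+1) x i = 0.

End DiscreteProperties.

(* The artinian condition follows from [semisimple]; it is kept so that the
   definition does not depend on which notion of semisimple ring is meant. *)
Definition semisimple_artinian (R : pzRingType) :=
  semisimple R /\ right_artinian R.

Definition semilocal (R : pzRingType) := semisimple_artinian (quot_Jac R).

Definition semiperfect (R : pzRingType) :=
  semilocal R /\ idempotents_lift_mod_Jac R.

Definition semiprimary (R : pzRingType) := semilocal R /\ Jac_nilpotent R.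

Definition right_perfect (R : pzRingType) :=
  semilocal R /\ right_T_nilpotent_Jac R.

Definition left_perfect (R : pzRingType) :=
  semilocal R /\ left_T_nilpotent_Jac R.

Definition pi_inf_regular (R : pzRingType) :=
  forall n, (0 < n)%N -> pi_regular 'M[R]_n.

(* A topology as a term, so that one can quantify over the topologies of a
   given ring; [topologize tau] is the corresponding topological space. *)
Record topology_on (T : Type) := TopologyOn {
  opens : set_system T;
  opens_setT : opens setT;
  opens_setI : setI_closed opens;
  opens_bigcup : forall (I : Type) (f : I -> set T),
    (forall i, opens (f i)) -> opens (\bigcup_i f i)
}.

Definition topologize (T : Type) (tau : topology_on T) : Type := T.

HB.instance Definition _ (T : choiceType) (tau : topology_on T) :=
  Choice.copy (topologize tau) T.
HB.instance Definition _ (T : choiceType) (tau : topology_on T) :=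
  isOpenTopological.Build (topologize tau)
    (opens_setT tau) (@opens_setI _ tau) (@opens_bigcup _ tau).
HB.instance Definition _ (R : pzRingType) (tau : topology_on R) :=
  GRing.PzRing.copy (topologize tau) R.

Definition linear_ring_topology (R : pzRingType) (tau : topology_on R) :=
  let T := topologize tau in
  [/\ continuous (fun p : T * T => p.1 + p.2),
      continuous (fun x : T => - x),
      continuous (fun p : T * T => p.1 * p.2) &
      forall U : set T, nbhs (0 : T) U ->
        exists I : set R, [/\ ideal I, nbhs (0 : T) I & I `<=` U]].

Section MatrixTopology.
Variables (R : pzRingType) (tau : topology_on R) (n : nat).

(* the topology with local basis { M_n(I) : I an open ideal of R } at 0 *)
Let mx_opens : set_system 'M[R]_n :=
  [set U | forall A, U A -> exists I : set R,
    [/\ ideal I, opens tau I &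
        forall B : 'M[R]_n, (forall i j, I (B i j)) -> U (A + B)]].

Let mx_opens_setT : mx_opens setT.
Proof. by move=> A _; exists setT; split => //; apply: opens_setT. Qed.

Let mx_opens_setI : setI_closed mx_opens.
Proof.
move=> U V oU oV A [/oU[I [iI oI IU]] /oV[J [iJ oJ JV]]].
exists (I `&` J); split; last first.
- by move=> B IJB; split; [apply: IU | apply: JV] => i j; case: (IJB i j).
- exact: opens_setI.
case: iI iJ => [[I0 IB IM] MI] [[J0 JB JM] MJ]; split; last first.
  by move=> r x [Ix Jx]; split; [apply: MI | apply: MJ].
split=> //.
- by move=> x y [Ix Jx] [Iy Jy]; split; [apply: IB | apply: JB].
- by move=> x r [Ix Jx]; split; [apply: IM | apply: JM].
Qed.

Let mx_opens_bigcup (K : Type) (f : K -> set 'M[R]_n) :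
  (forall i, mx_opens (f i)) -> mx_opens (\bigcup_i f i).
Proof.
move=> of_ A [k _ /of_[I [iI oI If]]].
by exists I; split => // B IB; exists k => //; apply: If.
Qed.

Definition mx_topology : topology_on 'M[R]_n :=
  TopologyOn mx_opens_setT mx_opens_setI mx_opens_bigcup.

End MatrixTopology.

Definition quasi_pi_regular (R : pzRingType) (tau : topology_on R) :=
  [/\ linear_ring_topology tau, hausdorff_space (topologize tau) &
    forall a : topologize tau, exists e : topologize tau, let f := 1 - e in
      [/\ e * e = e,
          a = e * a * e + f * a * f,
          exists b, [/\ b = e * b * e, (e * a * e) * b = e
                                      & b * (e * a * e) = e] &
          (fun k => (f * a * f) ^+ k) @ \oo --> (0 : topologize tau)]].

Definition quasi_pi_inf_regular (R : pzRingType) (tau : topology_on R) :=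
  [/\ linear_ring_topology tau, hausdorff_space (topologize tau) &
    forall n, (0 < n)%N -> quasi_pi_regular (mx_topology tau n)].

Definition subring (R : pzRingType) (S : subringClosed R) := {x : R | x \in S}.

HB.instance Definition _ (R : pzRingType) (S : subringClosed R) :=
  SubChoice.on (subring S).
HB.instance Definition _ (R : pzRingType) (S : subringClosed R) :=
  GRing.SubChoice_isSubPzRing.Build R _ (subring S) (GRing.subringClosedP S).

Section Center.
Variable R : pzRingType.

Definition center : {pred R} := fun x => `[< forall y : R, x * y = y * x >].

Lemma centerP x : reflect (forall y : R, x * y = y * x) (x \in center).
Proof. exact: asboolP. Qed.

Lemma center_subring_closed : subring_closed center.
Proof.
split=> [|x y /centerP xC /centerP yC|x y /centerP xC /centerP yC];
  apply/centerP => z.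
- by rewrite mul1r mulr1.
- by rewrite mulrBl mulrBr xC yC.
- by rewrite -mulrA yC !mulrA xC.
Qed.

HB.instance Definition _ :=
  GRing.isSubringClosed.Build R center center_subring_closed.

Definition commutative_subring (S : subringClosed R) :=
  {in S &, forall x y : R, x * y = y * x}.

Definition maximal_commutative_subring (S : subringClosed R) :=
  commutative_subring S /\
  forall S' : subringClosed R,
    commutative_subring S' -> {subset S <= S'} -> {subset S' <= S}.

End Center.

Arguments center R : clear implicits.

Definition prod_ring (I : Type) (A : I -> pzRingType) : Type := forall i, A i.

Section ProdRing.
Variables (I : Type) (A : I -> pzRingType).
Implicit Types x y z : prod_ring A.

HB.instance Definition _ := gen_eqMixin (prod_ring A).
HB.instance Definition _ := gen_choiceMixin (prod_ring A).

Let zero : prod_ring A := fun i => 0.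
Let one : prod_ring A := fun i => 1.
Let opp x : prod_ring A := fun i => - x i.
Let add x y : prod_ring A := fun i => x i + y i.
Let mul x y : prod_ring A := fun i => x i * y i.

Let addA : associative add.
Proof. by move=> x y z; apply/functional_extensionality_dep => i; apply: addrA. Qed.
Let addC : commutative add.
Proof. by move=> x y; apply/functional_extensionality_dep => i; apply: addrC. Qed.
Let add0 : left_id zero add.
Proof. by move=> x; apply/functional_extensionality_dep => i; apply: add0r. Qed.
Let addN : left_inverse zero opp add.
Proof. by move=> x; apply/functional_extensionality_dep => i; apply: addNr. Qed.
Let mulA : associative mul.
Proof. by move=> x y z; apply/functional_extensionality_dep => i; apply: mulrA. Qed.
Let mul1 : left_id one mul.
Proof. by move=> x; apply/functional_extensionality_dep => i; apply: mul1r. Qed.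
Let mulr1' : right_id one mul.
Proof. by move=> x; apply/functional_extensionality_dep => i; apply: mulr1. Qed.
Let mulDl : left_distributive mul add.
Proof. by move=> x y z; apply/functional_extensionality_dep => i; apply: mulrDl. Qed.
Let mulDr : right_distributive mul add.
Proof. by move=> x y z; apply/functional_extensionality_dep => i; apply: mulrDr. Qed.

HB.instance Definition _ := GRing.isPzRing.Build (prod_ring A)
  addA addC add0 addN mulA mul1 mulr1' mulDl mulDr.

End ProdRing.

(* Transition maps need not be surjective. *)
Record inverse_system := InverseSystem {
  index_disp : Order.disp_t;
  index : preorderType index_disp;
  index_inhabited : inhabited index;
  index_directed : forall i j : index, exists k, (i <= k)%O && (j <= k)%O;
  obj : index -> pzRingType;
  trans : forall i j, (i <= j)%O -> {rmorphism obj j -> obj i};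
  trans_id : forall i (ii : (i <= i)%O) x, trans ii x = x;
  trans_comp : forall i j k (ij : (i <= j)%O) (jk : (j <= k)%O)
    (ik : (i <= k)%O) x, trans ij (trans jk x) = trans ik x
}.

Section InverseLimit.
Variable A : inverse_system.

Definition thread : {pred prod_ring (@obj A)} := fun x =>
  `[< forall (i j : index A) (ij : (i <= j)%O), trans ij (x j) = x i >].

Lemma threadP x :
  reflect (forall (i j : index A) (ij : (i <= j)%O), trans ij (x j) = x i)
    (x \in thread).
Proof. exact: asboolP. Qed.

Lemma thread_subring_closed : subring_closed thread.
Proof.
split=> [|x y /threadP xT /threadP yT|x y /threadP xT /threadP yT];
  apply/threadP => i j ij.
- exact: rmorph1.
- by rewrite [LHS]rmorphB xT yT.
- by rewrite [LHS]rmorphM xT yT.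
Qed.

HB.instance Definition _ :=
  GRing.isSubringClosed.Build (prod_ring (@obj A)) thread thread_subring_closed.

Definition inverse_limit : pzRingType := subring thread.

Definition inverse_limit_incl (x : inverse_limit) :
  prod_topology (fun i => discrete_topology (@obj A i)) := \val x.

(* the ring [inverse_limit] with the subspace topology of the product of the
   discrete spaces [obj i] *)
Definition inverse_limit_space := initial_topology inverse_limit_incl.

HB.instance Definition _ := Topological.on inverse_limit_space.

End InverseLimit.

Definition pro (Q : pzRingType -> Prop) (R : pzRingType)
    (tau : topology_on R) :=
  exists2 A : inverse_system, forall i, Q (@obj A i) &
    exists (f : {rmorphism R -> inverse_limit A}) (g : inverse_limit A -> R),
      [/\ cancel f g, cancel g f,
          continuous (f : topologize tau -> inverse_limit_space A) &
          continuous (g : inverse_limit_space A -> topologize tau)].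

Inductive disc_property :=
  | Semiprimary
  | RightPerfect
  | LeftPerfect
  | PiInfRegularSemiperfect
  | PiInfRegular
  | PiRegularSemiperfect
  | PiRegular.

Definition satisfies_disc (Q : disc_property) (R : pzRingType) : Prop :=
  match Q with
  | Semiprimary => semiprimary R
  | RightPerfect => right_perfect R
  | LeftPerfect => left_perfect R
  | PiInfRegularSemiperfect => pi_inf_regular R /\ semiperfect R
  | PiInfRegular => pi_inf_regular R
  | PiRegularSemiperfect => pi_regular R /\ semiperfect R
  | PiRegular => pi_regular R
  end.

Inductive top_property :=
  | Pro of disc_property
  | ProSemiperfect of disc_property
  | QuasiPiInfRegular
  | QuasiPiInfRegularSemiperfect
  | QuasiPiRegular
  | QuasiPiRegularSemiperfect.

Definition satisfies_wrt (P : top_property) (R : pzRingType)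
    (tau : topology_on R) : Prop :=
  match P with
  | Pro Q => pro (satisfies_disc Q) tau
  | ProSemiperfect Q => pro (satisfies_disc Q) tau /\ semiperfect R
  | QuasiPiInfRegular => quasi_pi_inf_regular tau
  | QuasiPiInfRegularSemiperfect => quasi_pi_inf_regular tau /\ semiperfect R
  | QuasiPiRegular => quasi_pi_regular tau
  | QuasiPiRegularSemiperfect => quasi_pi_regular tau /\ semiperfect R
  end.

Inductive ring_property :=
  | Disc of disc_property
  | Top of top_property.

Definition satisfies (P : ring_property) (R : pzRingType) : Prop :=
  match P with
  | Disc Q => satisfies_disc Q R
  | Top P => exists2 tau : topology_on R,
      linear_ring_topology tau & satisfies_wrt P tau
  end.

(* Main.v *)
From HB Require Import structures.
Require Import Defs.
From mathcomp Require Import all_boot all_algebra.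
From mathcomp Require Import order all_classical topology.
From mathcomp Require Import ring.

(* Both the center and a maximal commutative subring are commutative and of the
   form S = C_R(X).  An element a of a (quasi-)pi-regular ring has a unique
   Drazin inverse, and it commutes with everything that commutes with a; hence
   S is closed under Drazin inverses, and the same applies to M_n(S), the
   centralizer in M_n(R) of the scalar matrices x with x in X.  Strong
   pi-regularity on both sides comes from Dischinger's theorem, and one-sided
   perfect rings are pi-regular by T-nilpotence of the radical.

   If R is semilocal then R, hence S, satisfies the descending chain condition
   on idempotents; as the idempotents of S generate all ideals of S/Jac(S), this
   makes S semiperfect.  Products of elements of Jac(S), which commute and are
   nilpotent, eventually fall into Jac(R) because R/Jac(R) is artinian, and this
   transfers T-nilpotence and nilpotence of the radical.

   If R is the limit of rings A_i, then S is the limit of commutative subrings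
   B_i of A_i that are again closed under Drazin inverses. *)

Set Implicit Arguments.
Unset Strict Implicit.
Unset Printing Implicit Defensive.

Import Order.TTheory GRing.Theory.
Local Open Scope classical_set_scope.
Local Open Scope ring_scope.

(** * Strongly pi-regular rings and Drazin inverses *)

Section RightPiRegular.
Variable R : pzRingType.
Implicit Types a b c x y z t : R.

Definition right_pi_regular := forall a, exists n x, a ^+ n = a ^+ n.+1 * x.

Lemma pi_regularP : pi_regular R <-> right_pi_regular.
Proof.
split=> Rpi a; have [n] := Rpi a.
  move=> /(_ n.+1 (leqnSn n)) E; exists n.
  have [x _ ax] : range (fun x => a ^+ n.+1 * x) (a ^+ n).
    by rewrite E; exists 1; rewrite ?mulr1.
  by exists x.
case=> x ax; exists n => m /subnK <-; move: (m - n)%N => {m} k.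
elim: k => [|k <-] //; apply/seteqP; split=> _ [y _ <-].
  by exists (a * y) => //; rewrite addSn exprSr mulrA.
exists (x * y) => //; rewrite mulrA; congr (_ * y).
by rewrite addSnnS !exprD -mulrA -ax.
Qed.

Lemma expr_sqr_inv a b k : a = a * a * b -> a ^+ k.+1 * b ^+ k = a.
Proof.
move=> ab; elim: k => [|k IH]; first by rewrite mulr1.
by rewrite exprS [b ^+ _]exprSr !mulrA -(mulrA a) IH -ab.
Qed.

Lemma sqr_inv_expr a b k : a = a * a * b -> a ^+ k = a ^+ k * a ^+ k * b ^+ k.
Proof.
move=> ab; case: k => [|k]; first by rewrite !mulr1.
by rewrite {1 2}exprSr -!mulrA (mulrA a) -exprS expr_sqr_inv.
Qed.

(** Iterating gives a^n = a^(n+k) x^k; take k = n+1 and multiply by a, which also keeps the exponent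
    positive. *)
Lemma right_pi_regular_sqr a : right_pi_regular ->
  exists n x, a ^+ n.+1 = a ^+ n.+1 * a ^+ n.+1 * x.
Proof.
move=> /(_ a)[n [x ax]].
have an k : a ^+ n = a ^+ (n + k) * x ^+ k.
  elim: k => [|k IH]; first by rewrite addn0 mulr1.
  by rewrite {1}ax exprS {1}IH addnS exprS exprSr !mulrA.
exists n, (x ^+ n.+1).
by rewrite -exprD addSn [LHS]exprS {1}(an n.+1) mulrA -exprS.
Qed.

(* Dischinger's theorem *)
Lemma right_pi_regular_left a : right_pi_regular ->
  exists n y, a ^+ n.+1 = y * (a ^+ n.+1 * a ^+ n.+1).
Proof.
move=> Rpi.
(* Regularity of [a], then of the resulting [b0], gives p = p p b and b = b b c after passing to
   common powers. *)
have [n [b0 ab0]] := right_pi_regular_sqr a Rpi.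
have [m [c]] := right_pi_regular_sqr b0 Rpi.
have := sqr_inv_expr m.+1 ab0.
set b := b0 ^+ m.+1; rewrite -exprM.
have -> : (n.+1 * m.+1 = (n * m.+1 + m).+1)%N by rewrite mulSn addnC addnS.
set N := (_ + m)%N; set p := a ^+ N.+1 => pb bc; exists N.
rewrite -/p; clearbody p b => {ab0}.
have pbc : p * b * c = p by rewrite {1}pb -!mulrA (mulrA b) -bc mulrA -pb.
have pc : p * c = p * p by rewrite {1}pb -!mulrA (mulrA p b) pbc.
(* The defect [d] is killed by p on the left. Regularity of [d] gives b d = b c d y, so p b d = p d
   y = 0, that is, p b p = p. *)
pose d := c - p.
have pd : p * d = 0 by rewrite mulrBr pc subrr.
have dE k : d ^+ k.+1 = c ^+ k * d.
  elim: k => [|k IH]; first by rewrite mul1r.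
  by rewrite exprSr IH exprSr -!mulrA {1}/d mulrBl pd subr0.
have [k [y dy]] := Rpi d.
have bd : b * d = b * c * d * y.
  have := congr1 (fun u => b ^+ k.+1 * (d * u)) dy.
  rewrite /= -exprS (mulrA d) -exprS !dE !mulrA (expr_sqr_inv _ bc) => ->.
  by rewrite [c ^+ _]exprSr mulrA (expr_sqr_inv _ bc).
have pbp : p * b * p = p.
  apply/esym/eqP; rewrite -subr_eq0 -{1}pbc -mulrBr -/d -mulrA bd !mulrA pbc.
  by rewrite pd mul0r.
(* In the corner e R e, [b1] is a right inverse of p; regularity of [b1] itself makes it a two-sided
   one. *)
pose e := p * b; have ee : e * e = e by rewrite /e mulrA pbp.
have pe : p * e = p by rewrite /e mulrA -pb.
have ep : e * p = p by [].
pose b1 := e * b * e; have eb1 : e * b1 = b1 by rewrite /b1 2!(mulrA e) ee.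
have b1e : b1 * e = b1 by rewrite /b1 -(mulrA _ e e) ee.
have pb1 : p * b1 = e by rewrite /b1 2!(mulrA p) pe -/e ee.
clearbody e b1.
have pb1k j : p ^+ j.+1 * b1 ^+ j.+1 = e.
  elim: j => [|j IH] //.
  by rewrite exprSr [b1 ^+ _]exprS mulrA -(mulrA _ p) pb1 [b1 ^+ _]exprS -mulrA
    (mulrA e) eb1 -exprS.
have [j [x b1x]] := Rpi b1.
have ex : e = b1 * x.
  have := congr1 (fun u => p ^+ j.+1 * (b1 * u)) b1x.
  by rewrite /= -exprS (mulrA b1) -exprS pb1k
    [b1 ^+ _]exprSr -mulrA mulrA pb1k mulrA eb1.
have b1p : b1 * p = e.
  by rewrite -pe {1}ex (mulrA p) pb1 !mulrA b1e -ex.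
by exists b1; rewrite mulrA b1p ep.
Qed.

End RightPiRegular.

Section Drazin.
Variable R : pzRingType.
Implicit Types (a z t : R) (B : set (set R)).

(* For B = {0} this is the usual Drazin inverse; with B a basis of open ideals,
   the last condition says that a (1 - a z) is topologically nilpotent. *)
Definition drazin B a z :=
  [/\ a * z = z * a, z * a * z = z &
      forall I, B I -> exists n, I (a ^+ n * (1 - a * z))].

Definition drazin_ring B := forall a, exists z, drazin B a z.

(** The algebraic form of the Hausdorff condition: identities are proved modulo each member of
    [B]. *)
Definition separating B :=
  (forall I, B I -> ideal I) /\ forall x, (forall I, B I -> I x) -> x = 0.

Definition zero_ideal : set (set R) := [set [set 0]].

Lemma separating_zero_ideal : separating zero_ideal.
Proof.
split=> [_ ->|x /(_ [set 0]) xB]; last exact: xB.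
split=> [|r x ->]; last by rewrite mulr0.
by split=> [//|x y -> ->|x r ->]; rewrite ?subr0 ?mul0r.
Qed.

Lemma drazin_idem B a z : drazin B a z -> a * z * (a * z) = a * z.
Proof. by case=> _ zaz _; rewrite -mulrA (mulrA z) zaz. Qed.

Lemma drazinXC B a z n : drazin B a z -> a ^+ n * (a * z) = a * z * a ^+ n.
Proof.
by case=> azC _ _; symmetry; apply: commrX; rewrite /GRing.comm -mulrA azC.
Qed.

Lemma drazin_idemX B a z n :
  drazin B a z -> a * z = z ^+ n * (a ^+ n * (a * z)).
Proof.
move=> az; have [azC _ _] := az; elim: n => [|n IH]; first by rewrite !mul1r.
rewrite exprSr exprS -!mulrA (mulrA z a) -azC (drazinXC n az).
by rewrite (mulrA (a * z)) (drazin_idem az) -(drazinXC n az).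
Qed.

(** With e = a z, extracting a^n from e and moving it past t gives e t (1 - e) and (1 - e) t e a
    factor a^n (1 - e). Both lie in every member of [B], so e commutes with t, and so does z = z e =
    e z. *)
Lemma drazin_commr B a z t : separating B -> drazin B a z ->
  a * t = t * a -> z * t = t * z.
Proof.
move=> [idB sepB] az at_; have [azC zaz azB] := az; set e := a * z in azB *.
have atX n : a ^+ n * t = t * a ^+ n by symmetry; apply: commrX.
have aeX n : a ^+ n * e = e * a ^+ n by apply: drazinXC az.
have etf : e * t * (1 - e) = 0.
  apply: sepB => I BI; have [n aI] := azB I BI; have [_ Il] := idB I BI.
  suff -> : e * t * (1 - e) = z ^+ n * e * t * (a ^+ n * (1 - e)) by apply: Il.
  rewrite {1}/e (drazin_idemX n az) -/e aeX !mulrA; congr (_ * _).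
  by rewrite -!mulrA atX.
have fte : (1 - e) * t * e = 0.
  apply: sepB => I BI; have [n aI] := azB I BI; have [[_ _ Ir] Il] := idB I BI.
  have -> : (1 - e) * t * e = a ^+ n * (1 - e) * (t * (z ^+ n * e)).
    rewrite {2}/e (drazin_idemX n az) -/e.
    have -> : z ^+ n * (a ^+ n * e) = a ^+ n * (z ^+ n * e).
      rewrite (mulrA (z ^+ n)) (mulrA (a ^+ n)); congr (_ * e).
      by apply: commrX; symmetry; apply: commrX.
    rewrite (mulrA _ (a ^+ n)) (mulrA _ t (_ * _)); congr (_ * _).
    rewrite -(mulrA (1 - e)) -atX mulrA; congr (_ * _).
    by rewrite mulrBl mulrBr mul1r mulr1 aeX.
  exact: Ir.
have et : e * t = t * e.
  move/eqP: etf; rewrite mulrBr mulr1 subr_eq0 => /eqP ->.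
  by move/eqP: fte; rewrite -mulrA mulrBl mul1r subr_eq0 mulrA => /eqP ->.
have ez : e * z = z by rewrite /e azC.
have ze : z * e = z by rewrite mulrA.
rewrite -{1}ze -mulrA et.
have -> : z * (t * e) = e * t * z by rewrite /e (mulrA t) -at_ !mulrA -azC.
by rewrite et -mulrA ez.
Qed.

(** The idempotents a z1 and a z2 absorb each other modulo [B] and commute by [drazin_commr], so
    they agree; then z1 = z1 a z1 = a z2 z2 = z2. *)
Lemma drazin_uniq B a z1 z2 : separating B ->
  drazin B a z1 -> drazin B a z2 -> z1 = z2.
Proof.
move=> sB az1 az2; have [az1C zaz1 az1B] := az1; have [az2C zaz2 az2B] := az2.
have [idB sepB] := sB.
have eE z z' : drazin B a z -> drazin B a z' -> a * z = a * z * (a * z').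
  move=> az [_ _ az'B]; apply/eqP; rewrite -subr_eq0 -{1}[a * z]mulr1 -mulrBr.
  apply/eqP/sepB => I BI; have [n aI] := az'B I BI; have [_ Il] := idB I BI.
  by rewrite (drazin_idemX n az) (drazinXC n az) -2!mulrA mulrA; apply: Il.
have e12 : a * z1 = a * z2.
  rewrite (eE _ _ az1 az2) [RHS](eE _ _ az2 az1).
  have ae2 : a * (a * z2) = a * z2 * a by have := drazinXC 1 az2.
  have z1e2 : z1 * (a * z2) = a * z2 * z1 by apply: (drazin_commr sB az1).
  by rewrite -mulrA z1e2 mulrA ae2 -mulrA.
by rewrite -zaz1 -mulrA e12 mulrA -az1C e12 az2C zaz2.
Qed.

(** In the corner of e = p x = y p, the element g = e x inverts p. It commutes with whatever
    commutes with p, in particular with a, and a^n g is the Drazin inverse. *)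
Lemma sqr_inv_drazin a n x y :
  a ^+ n.+1 = a ^+ n.+1 * a ^+ n.+1 * x ->
  a ^+ n.+1 = y * (a ^+ n.+1 * a ^+ n.+1) ->
  exists z, drazin zero_ideal a z.
Proof.
set p := a ^+ n.+1 => px yp; set e := p * x.
have eE : e = y * p by rewrite /e {1}yp -!mulrA (mulrA p) -px.
have pe : p * e = p by rewrite mulrA -px.
have ep : e * p = p by rewrite eE -mulrA -yp.
pose g := e * x.
have pg : p * g = e by rewrite mulrA pe.
have gE : g = y * e by rewrite /g {1}eE -mulrA.
have gp : g * p = e by rewrite gE -mulrA ep.
have ee : e * e = e by rewrite {1}eE -mulrA pe.
have eg : e * g = g by rewrite mulrA ee.
have ge : g * e = g by rewrite gE -mulrA ee.
have gC t : p * t = t * p -> g * t = t * g.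
  move=> pt.
  have et1 : e * t * e = e * t by rewrite {1 3}eE -!mulrA (mulrA p) pt -mulrA pe.
  have et2 : e * t * e = t * e.
    have te : t * e = p * t * x by rewrite /e mulrA -pt.
    by rewrite -mulrA te !mulrA ep.
  have et : e * t = t * e by rewrite -et1 et2.
  by rewrite -{1}ge -mulrA et -{1}pg (mulrA t) -pt 2!mulrA gp et -mulrA eg.
have ag : a * g = g * a by apply/esym/gC; rewrite -exprS -exprSr.
have aX : a * (a ^+ n * g) = e by rewrite mulrA -exprS.
exists (a ^+ n * g); split.
- by rewrite aX -mulrA -ag mulrA -exprSr.
- by rewrite -mulrA aX -mulrA ge.
- by move=> _ ->; exists n.+1; rewrite /= aX mulrBr mulr1 pe subrr.
Qed.

Lemma right_pi_regular_drazin : right_pi_regular R <-> drazin_ring zero_ideal.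
Proof.
split=> [Rpi a|RD a]; last first.
  have [z [azC _ /(_ _ erefl)[n]]] := RD a => /eqP.
  by rewrite mulrBr mulr1 subr_eq0 mulrA -exprSr => /eqP an; exists n, z.
have [n [x ax]] := right_pi_regular_sqr a Rpi.
have [m [y ay]] := right_pi_regular_left a Rpi.
have E : (n.+1 * m.+1 = (n * m.+1 + m).+1)%N by rewrite mulSn addnC addnS.
have := sqr_inv_expr m.+1 ax; rewrite -exprM E => {}ax.
(* Read in the opposite ring, the left-hand equation can also be raised to the common exponent
   (n+1)(m+1). *)
have ay' : (a ^+ m.+1 : R^c) = (a ^+ m.+1 : R^c) * (a ^+ m.+1 : R^c) * (y : R^c).
  exact: ay.
have := sqr_inv_expr n.+1 ay'; rewrite !revrX -exprM mulnC E.
by move=> ay2; apply: (sqr_inv_drazin ax ay2).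
Qed.

End Drazin.
Arguments zero_ideal R : clear implicits.

(** * Transfer of Drazin inverses to centralizers and matrix rings *)

Definition preim_ideals (A R : pzRingType) (f : A -> R) (B : set (set R)) :=
  [set f @^-1` I | I in B].

Definition mx_ideals (R : pzRingType) n (B : set (set R)) :=
  [set [set M : 'M[R]_n | forall i j, I (M i j)] | I in B].
Arguments mx_ideals {R} n B.

(* The families C and the condition relating them to B make the images of a
   Drazin inverse in the rings T k Drazin inverses again. *)
Variant semicentral (A R : pzRingType) (B : set (set R))
    (f : {rmorphism A -> R}) : Prop :=
  Semicentral (K : Type) (T : K -> pzRingType)
    (phi : forall k, {rmorphism R -> T k})
    (C : forall k, set (set (T k))) (Y : forall k, set (T k)) of
    injective f & (forall k, separating (C k)) &
    (forall k I, C k I -> exists2 J, B J & J `<=` phi k @^-1` I) &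
    (forall r, (exists a, f a = r) <->
      (forall k y, Y k y -> phi k r * y = y * phi k r)).

Lemma drazin_morph (R T : pzRingType) (phi : {rmorphism R -> T}) B C a z :
  (forall I, C I -> exists2 J, B J & J `<=` phi @^-1` I) ->
  drazin B a z -> drazin C (phi a) (phi z).
Proof.
move=> CB [az zaz azB]; split; first by rewrite -!rmorphM az.
  by rewrite -!rmorphM zaz.
move=> I /CB[J /azB[n aJ] JI]; exists n; have := JI _ aJ => /=.
by rewrite rmorphM rmorphXn rmorphB rmorph1 rmorphM.
Qed.

Lemma ideal_preim (A R : pzRingType) (f : {rmorphism A -> R}) I :
  ideal I -> ideal (f @^-1` I).
Proof.
move=> [[I0 IB Ir] Il]; split; last by move=> r x /= Ix; rewrite rmorphM; apply: Il.
split=> /= [|x y Ix Iy|x r Ix]; first by rewrite rmorph0.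
  by rewrite rmorphB; apply: IB.
by rewrite rmorphM; apply: Ir.
Qed.

Lemma separating_preim (A R : pzRingType) (f : {rmorphism A -> R}) B :
  injective f -> separating B -> separating (preim_ideals f B).
Proof.
move=> fI [idB sepB]; split=> [_ [I BI <-]|x xB]; first exact/ideal_preim/idB.
apply: fI; rewrite rmorph0; apply: sepB => I BI.
by apply: (xB (f @^-1` I)); exists I.
Qed.

Lemma ideal_sum (R : pzRingType) (I : set R) (J : finType) (F : J -> R) :
  ideal I -> (forall j, I (F j)) -> I (\sum_j F j).
Proof.
move=> [rI _] IF; apply: (big_ind I) => //; first by case: rI.
by move=> x y; apply: right_idealD.
Qed.

Lemma ideal_mx (R : pzRingType) n (I : set R) :
  ideal I -> ideal [set M : 'M[R]_n | forall i j, I (M i j)].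
Proof.
move=> iI; have [[I0 IB Ir] Il] := iI; split; last first.
  by move=> A M IM i j; rewrite mxE; apply: ideal_sum => // k; apply: Il.
split=> [i j|M N IM IN i j|M A IM i j]; rewrite ?mxE //.
  by rewrite -[_ + _]/(M i j - N i j); apply: IB.
by apply: ideal_sum => // k; apply: Ir.
Qed.

Lemma separating_mx (R : pzRingType) n (B : set (set R)) :
  separating B -> separating (mx_ideals n B).
Proof.
move=> [idB sepB]; split=> [_ [I BI <-]|M MB]; first exact/ideal_mx/idB.
apply/matrixP => i j; rewrite mxE; apply: sepB => I BI.
by apply: (MB [set N : 'M[R]_n | forall i j, I (N i j)]); exists I.
Qed.

Lemma scalar_mx_commP (T : pzRingType) n (M : 'M[T]_n) y :
  (M * y%:M = y%:M * M) <-> (forall i j, M i j * y = y * M i j).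
Proof.
rewrite -[M * _]/(M *m _) -[_ * M]/(_ *m M) -diag_const_mx.
split=> [/matrixP E i j|E]; last apply/matrixP => i j.
  by have := E i j; rewrite mul_mx_diag mul_diag_mx !mxE.
by rewrite mul_mx_diag mul_diag_mx !mxE.
Qed.

(** Commuting with [y%:M] is an entrywise condition, so the scalar matrices over [Y k] cut out the
    matrices with entries in the image of f. *)
Lemma semicentral_mx (A R : pzRingType) (B : set (set R))
    (f : {rmorphism A -> R}) n :
  semicentral B f -> semicentral (mx_ideals n B) (map_mx f : {rmorphism 'M_n -> 'M_n}).
Proof.
case=> K T phi C Y fI sepC CB imf.
pose Yn k := [set y%:M | y in Y k] : set 'M[T k]_n.
apply: (@Semicentral _ _ _ _ K (fun k => 'M[T k]_n) (fun k => map_mx (phi k))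
  (fun k => mx_ideals n (C k)) Yn).
- move=> M N /matrixP MN; apply/matrixP => i j; apply: fI.
  by have := MN i j; rewrite !mxE.
- by move=> k; apply: separating_mx.
- move=> k _ [I /CB[J BJ JI] <-].
  exists [set M : 'M[R]_n | forall i j, J (M i j)]; first by exists J.
  by move=> M JM i j; rewrite mxE; apply: JI.
move=> M; split=> [[N <-] k _ [y Yy <-]|MY].
  apply/scalar_mx_commP => i j; rewrite !mxE.
  by have [imf' _] := imf (f (N i j)); apply: imf' => //; exists (N i j).
have {}MY i j : exists a, f a = M i j.
  apply/imf => k y Yy; have /scalar_mx_commP := MY k _ (ex_intro2 _ _ y Yy erefl).
  by move=> /(_ i j); rewrite mxE.
exists (\matrix_(i, j) sval (cid (MY i j))); apply/matrixP => i j; rewrite !mxE.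
exact: (svalP (cid (MY i j))).
Qed.

(** Each [phi k] maps the Drazin inverse of f a to a Drazin inverse, which commutes with [Y k] by
    [drazin_commr]; so it comes from A. *)
Lemma semicentral_drazin (A R : pzRingType) (B : set (set R))
    (f : {rmorphism A -> R}) :
  semicentral B f -> drazin_ring B -> drazin_ring (preim_ideals f B).
Proof.
case=> K T phi C Y fI sepC CB imf RB a; have [z az] := RB (f a).
have [imf' _] := imf (f a).
have [z' fz'] : exists z', f z' = z.
  apply/imf => k y Yy; apply: (drazin_commr (sepC k) (drazin_morph (CB k) az)).
  by apply: imf' => //; exists a.
move: az; rewrite -fz' => -[az zaz azB]; exists z'; split.
- by apply: fI; rewrite !rmorphM.
- by apply: fI; rewrite !rmorphM.
- move=> _ [I BI <-]; have [n aI] := azB I BI; exists n => /=.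
  by rewrite rmorphM rmorphXn rmorphB rmorph1 rmorphM.
Qed.

Lemma drazin_ring_sub (R : pzRingType) (B C : set (set R)) :
  (forall I, C I -> exists2 J, B J & J `<=` I) -> drazin_ring B -> drazin_ring C.
Proof.
move=> CB RB a; have [z [az zaz azB]] := RB a; exists z; split=> // I /CB[J BJ JI].
by have [n aJ] := azB J BJ; exists n; apply: JI.
Qed.

Lemma drazin_ring_mx1 (R : pzRingType) (B : set (set R)) :
  drazin_ring (mx_ideals 1 B) -> drazin_ring B.
Proof.
move=> RB a; have [z] := RB a%:M; rewrite (mx11_scalar z); set b := z 0 0.
case=> az zaz azB.
have injs : injective (@scalar_mx R 1).
  by move=> x y /matrixP/(_ 0 0); rewrite !mxE.
exists b; split.
- by apply: injs; rewrite !rmorphM.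
- by apply: injs; rewrite !rmorphM.
- move=> I BI; have [|n] := azB [set M : 'M[R]_1 | forall i j, I (M i j)].
    by exists I.
  move=> /(_ 0 0) aI; exists n.
  move: aI; rewrite -rmorphXn -rmorphM.
  by rewrite -(rmorph1 (@scalar_mx R 1)) -rmorphB -rmorphM mxE mulr1n.
Qed.

Lemma preim_zero_ideal (A R : pzRingType) (f : {rmorphism A -> R}) :
  injective f -> preim_ideals f (zero_ideal R) = zero_ideal A.
Proof.
move=> fI; have E : f @^-1` [set 0] = [set 0].
  apply/seteqP; split=> x /=; last by move=> ->; rewrite rmorph0.
  by rewrite -[in f _ = _](rmorph0 f) => /fI.
by rewrite /preim_ideals /zero_ideal image_set1 E.
Qed.

Lemma mx_zero_ideal (R : pzRingType) n :
  mx_ideals n (zero_ideal R) = zero_ideal 'M[R]_n.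
Proof.
rewrite /mx_ideals /zero_ideal image_set1; congr [set _].
apply/seteqP; split=> M /= M0; first by apply/matrixP => i j; rewrite mxE M0.
by move=> i j; rewrite M0 mxE.
Qed.

Lemma pi_inf_regularP (R : pzRingType) : pi_inf_regular R <->
  forall n, (0 < n)%N -> drazin_ring (mx_ideals n (zero_ideal R)).
Proof.
by split=> RP n /RP; rewrite mx_zero_ideal pi_regularP right_pi_regular_drazin.
Qed.

Lemma pi_inf_regularW (R : pzRingType) : pi_inf_regular R -> pi_regular R.
Proof.
move=> /pi_inf_regularP/(_ 1%N isT)/drazin_ring_mx1.
by rewrite pi_regularP right_pi_regular_drazin.
Qed.

Lemma semicentral_pi_regular (A R : pzRingType) (f : {rmorphism A -> R}) :
  semicentral (zero_ideal R) f -> pi_regular R -> pi_regular A.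
Proof.
move=> fC; rewrite !pi_regularP !right_pi_regular_drazin.
have fI : injective f by case: fC.
by rewrite -(preim_zero_ideal fI); apply: semicentral_drazin.
Qed.

Lemma semicentral_pi_inf_regular (A R : pzRingType) (f : {rmorphism A -> R}) :
  semicentral (zero_ideal R) f -> pi_inf_regular R -> pi_inf_regular A.
Proof.
move=> fC RP n /RP; apply: semicentral_pi_regular (map_mx f) _.
by rewrite -mx_zero_ideal; apply: semicentral_mx.
Qed.

(** * The Jacobson radical and semilocal rings *)

Section JacobsonRadical.
Variable R : pzRingType.
Implicit Types x y s e : R.

Lemma exists_maximal_right_ideal (J : set R) : right_ideal J -> ~ J 1 ->
  exists2 M, maximal_right_ideal M & J `<=` M.
Proof.
move=> rJ J1.
(* Taking the union with J inside [P] lets the empty chain, whose union is empty, satisfy [P]. *)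
pose P (I : set R) := right_ideal (J `|` I) /\ ~ (J `|` I) 1.
have [F FP Ftot|A [[rA A1] Amax]] := @Zorn_bigcup R P.
  have [[I0 FI0]|F0] := pselect (exists I, F I); last first.
    suff -> : \bigcup_(X in F) X = set0 by rewrite /P setU0.
    by rewrite -subset0 => x [I FI _]; apply: F0; exists I.
  split; last first.
    move=> [//|[I FI I1]]; have [_] := FP _ FI; apply; right; exact: I1.
  have inF I x : F I -> (J `|` I) x -> (J `|` \bigcup_(X in F) X) x.
    by move=> FI [Jx|Ix]; [left | right; exists I].
  have outF x : (J `|` \bigcup_(X in F) X) x -> exists2 I, F I & (J `|` I) x.
    by move=> [Jx|[I FI Ix]]; [exists I0 => //; left | exists I => //; right].
  split.
  - by left; case: rJ.
  - move=> x y /outF[I FI Ix] /outF[I' FI' Iy].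
    wlog II' : I I' x y FI FI' Ix Iy / I `<=` I' => [W|].
      have [II'|I'I] := Ftot _ _ FI FI'; first exact: (W I I').
      have := W I' I y x FI' FI Iy Ix I'I => Fyx.
      have [[_ _ Fr] _] := FP _ FI.
      have [[_ FB _] _] := FP _ FI; apply: (inF I) => //; apply: FB => //.
      by case: Iy => [Jy|/I'I Iy]; [left | right].
    have [[_ FB _] _] := FP _ FI'; apply: (inF I') => //; apply: FB => //.
    by case: Ix => [Jx|/II' Ix]; [left | right].
  - move=> x r /outF[I FI Ix]; apply: (inF I) => //.
    by have [[_ _ Fr] _] := FP _ FI; apply: Fr.
exists (J `|` A); last by left.
split=> // [|I rI AI]; first by apply/eqP => E; apply: A1; rewrite E.
have [I1|I1] := pselect (I 1).
  by right; apply/seteqP; split=> // x _; rewrite -[x]mul1r; case: rI => _ _; apply.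
left; apply/seteqP; split=> //; apply: contrapT => IA.
have JI : J `|` I = I by apply/setUidPr => x Jx; apply: AI; left.
apply: (Amax I); last by rewrite /P JI.
split=> [x Ax|IA']; first by apply: AI; right.
by apply: IA => x /IA' Ax; right.
Qed.

(** Otherwise (1 - x s) R lies in a maximal right ideal, which also contains x s and hence 1. *)
Lemma Jac_right_inv x s : x \in Jac R -> exists y, (1 - x * s) * y = 1.
Proof.
move=> /JacP xJ; apply: contrapT => nU.
have rJ : right_ideal [set (1 - x * s) * y | y in setT].
  split=> [|_ _ [y _ <-] [z _ <-]|_ r [y _ <-]].
  - by exists 0; rewrite ?mulr0.
  - by exists (y - z); rewrite ?mulrBr.
  - by exists (y * r); rewrite ?mulrA.
have [[y _ yE]|M mM JM] := exists_maximal_right_ideal rJ.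
  by apply: nU; exists y.
have [rM MT _] := mM; have [_ _ Mr] := rM.
suff M1 : M 1.
  by move/eqP: MT; apply; apply/seteqP; split=> // y _; rewrite -[y]mul1r; apply: Mr.
rewrite -[1](subrK (x * s)); apply: right_idealD => //; last exact: Mr (xJ _ mM).
by apply: JM; exists 1; rewrite ?mulr1.
Qed.

(** If x is outside a maximal M, then 1 = m + x s with m in M; but m = 1 - x s is right
    invertible. *)
Lemma right_inv_Jac x : (forall s, exists y, (1 - x * s) * y = 1) -> x \in Jac R.
Proof.
move=> xU; apply/JacP => M mM; apply: contrapT => nMx.
have [rM MT Mmax] := mM; have [M0 MB Mr] := rM.
have [|m Mm|E|E] := Mmax [set m + x * s | m in M & s in setT].
- split=> [|_ _ [m Mm [s _ <-]] [m' Mm' [s' _ <-]]|_ r [m Mm [s _ <-]]].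
  + by exists 0 => //; exists 0; rewrite ?mulr0 ?addr0.
  + exists (m - m'); first exact: MB.
    by exists (s - s') => //; rewrite mulrBr opprD addrACA.
  + exists (m * r); first exact: Mr.
    by exists (s * r) => //; rewrite mulrDl mulrA.
- by exists m => //; exists 0; rewrite ?mulr0 ?addr0.
- by apply: nMx; rewrite -E; exists 0 => //; exists 1; rewrite ?mulr1 ?add0r.
have : [set: R] 1 by []; rewrite -E => -[m Mm [s _ ms]].
have [y sy] := xU s; move/eqP: MT; apply; apply/seteqP; split=> // z _.
by rewrite -[z]mul1r -sy -ms addrK -mulrA; apply: Mr.
Qed.

Lemma Jac_idem e : e * e = e -> e \in Jac R -> e = 0.
Proof.
move=> ee eJ; have [y] := Jac_right_inv 1 eJ; rewrite mulr1 => ye.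
by rewrite -[e]mulr1 -ye mulrA mulrBr mulr1 ee subrr mul0r.
Qed.

Definition pi_Jac x : quot_Jac R := (\pi_(Quotient.quot (Jac R)) x)%qT.

Lemma pi_Jac_surj (y : quot_Jac R) : exists x, pi_Jac x = y.
Proof. by exists (repr y); apply: reprK. Qed.

Lemma eq_pi_Jac x y : (x - y \in Jac R) <-> (pi_Jac x = pi_Jac y).
Proof. by rewrite Quotient.idealrBE; split=> /eqP. Qed.

Fact pi_Jac_zmod_morphism : zmod_morphism pi_Jac.
Proof. exact: (@raddfB _ _ (\pi_(Quotient.quot (Jac R)))%qT). Qed.

HB.instance Definition _ :=
  GRing.isZmodMorphism.Build R (quot_Jac R) pi_Jac pi_Jac_zmod_morphism.

Fact pi_Jac_monoid_morphism : monoid_morphism pi_Jac.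
Proof.
split=> // x y; rewrite -[LHS]/(pi_Jac (x * y)); symmetry; apply/eq_pi_Jac.
set x' := repr _; set y' := repr _.
have xJ : x' - x \in Jac R by apply/eq_pi_Jac/reprK.
have yJ : y' - y \in Jac R by apply/eq_pi_Jac/reprK.
have -> : x' * y' - x * y = (x' - x) * y' + x * (y' - y).
  by rewrite mulrBl mulrBr addrA subrK.
by apply: rpredD; [apply: JacMr | apply: JacMl].
Qed.

HB.instance Definition _ :=
  GRing.isMonoidMorphism.Build R (quot_Jac R) pi_Jac pi_Jac_monoid_morphism.

Lemma pi_Jac_eq0 x : (pi_Jac x = 0) <-> (x \in Jac R).
Proof. by rewrite -[x in x \in _]subr0 eq_pi_Jac rmorph0. Qed.

End JacobsonRadical.

(** The two product conditions say that e_(n+1) lies below e_n in the usual order of idempotents. *)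
Definition dcc_idempotents (R : pzRingType) :=
  forall e : nat -> R, (forall n, e n * e n = e n) ->
    (forall n, e n * e n.+1 = e n.+1) -> (forall n, e n.+1 * e n = e n.+1) ->
    exists n, forall m, (n <= m)%N -> e m = e n.

Section Semilocal.

Lemma right_ideal_principal (R : pzRingType) (a : R) :
  right_ideal (range (fun x => a * x)).
Proof.
split=> [|_ _ [x _ <-] [y _ <-]|_ r [x _ <-]]; first by exists 0; rewrite ?mulr0.
  by exists (x - y); rewrite ?mulrBr.
by exists (x * r); rewrite ?mulrA.
Qed.

(** The right ideals generated by the e_n modulo the radical stabilize, so e_n - e_k eventually lies
    in the radical; being idempotent, it is zero. *)
Lemma semilocal_dcc_idempotents (R : pzRingType) :
  semilocal R -> dcc_idempotents R.
Proof.
move=> [_ artR] e ee eS Se.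
have eD n k : e n * e (n + k)%N = e (n + k)%N /\ e (n + k)%N * e n = e (n + k)%N.
  elim: k => [|k [IH1 IH2]]; first by rewrite addn0.
  by rewrite addnS; split; [rewrite -eS mulrA IH1 | rewrite -Se -mulrA IH2].
have [n|n|n nI] := artR (fun n => range (fun x => pi_Jac (e n) * x)).
- exact: right_ideal_principal.
- by move=> _ [x _ <-]; exists (pi_Jac (e n.+1) * x); rewrite //= mulrA -rmorphM eS.
exists n => m nm; have := nI m nm; rewrite -(subnKC nm) => E.
have [eD1 eD2] := eD n (m - n)%N; move: (n + _)%N => k in E eD1 eD2 *.
have : range (fun x => pi_Jac (e k) * x) (pi_Jac (e n)).
  by rewrite E; exists 1; rewrite ?mulr1.
case=> x _ /= ex; apply/eqP; rewrite eq_sym -subr_eq0; apply/eqP/Jac_idem.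
  by rewrite mulrBr !mulrBl !ee eD1 eD2 subrr subr0.
have ekn : pi_Jac (e k) = pi_Jac (e n).
  by rewrite -[in LHS]eD2 rmorphM /= -ex mulrA -rmorphM ee.
by apply/pi_Jac_eq0; rewrite rmorphB /= ekn subrr.
Qed.

Lemma dcc_idempotents_inj (A R : pzRingType) (f : {rmorphism A -> R}) :
  injective f -> dcc_idempotents R -> dcc_idempotents A.
Proof.
move=> fI dccR e ee eS Se; have [n|n|n|n nE] := dccR (fun n => f (e n)).
- by rewrite -rmorphM ee.
- by rewrite -rmorphM eS.
- by rewrite -rmorphM Se.
by exists n => m nm; apply/fI/nE.
Qed.

(** * Commutative rings in which every element has a Drazin inverse *)

Section Commutative.
Variables (A : comPzRingType) (B : set (set A)).
Hypotheses (sepB : separating B) (AB : drazin_ring B).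

(** Let v be the Drazin inverse of u = 1 - x s. Modulo each I a finite geometric sum inverts u,
    while u^n (1 - u v) is in I for some n; so 1 - u v lies in every I, and u v = 1. *)
Lemma topologically_nilpotent_Jac (x : A) :
  (forall I, B I -> exists n, I (x ^+ n)) -> x \in Jac A.
Proof.
move=> xB; apply: right_inv_Jac => s.
have {}xB I : B I -> exists n, I ((x * s) ^+ n).
  move=> BI; have [n xI] := xB I BI; exists n; rewrite exprMn.
  by have [[_ _ Ir] _] := sepB.1 I BI; apply: Ir.
move: (x * s) xB => {s}x xB; set u := 1 - x.
have [v [_ _ uB]] := AB u; exists v.
apply/eqP; rewrite eq_sym -subr_eq0; apply/eqP/sepB.2 => I BI.
have [[_ IB Ir] Il] := sepB.1 I BI.
have [n un] := uB I BI; have [m xm] := xB I BI.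
set f := 1 - u * v in un *.
have [w uw] : exists w, I (1 - u * w).
  exists (\sum_(i < m) x ^+ i); suff -> : 1 - u * \sum_(i < m) x ^+ i = x ^+ m by [].
  by rewrite -[x ^+ m](subrK 1) subrX1 -[in RHS]opprB mulNr addrC.
have -> : f = u ^+ n * f * w ^+ n - ((u * w) ^+ n - 1) * f.
  by rewrite mulrBl mul1r opprB addrCA exprMn mulrAC subrr addr0.
apply: (IB); first exact: Ir.
rewrite subrX1 -opprB -mulrA mulNr -mulrN.
exact: Ir.
Qed.

(** The positive powers of a (1 - e) are a^k (1 - e), so it is topologically nilpotent. Hence a and
    e generate the same ideal modulo the radical. *)
Lemma drazin_Jac_idem (a : A) :
  exists e z, [/\ e * e = e, a * z = e & a * (1 - e) \in Jac A].
Proof.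
have [z az] := AB a; have [_ _ azB] := az.
exists (a * z), z; split=> //; first exact: drazin_idem az.
apply: topologically_nilpotent_Jac => I BI; have [n aI] := azB I BI.
exists n.+1; set f := 1 - _ in aI *.
have ff : f * f = f.
  by rewrite /f mulrBr mulr1 mulrBl mul1r (drazin_idem az) subrr subr0.
have fX k : f ^+ k.+1 = f by elim: k => // k IH; rewrite exprS IH.
rewrite exprMn fX exprSr mulrAC.
by have [[_ _ Ir] _] := sepB.1 I BI; apply: Ir.
Qed.

Lemma com_idempotents_lift : idempotents_lift_mod_Jac A.
Proof.
move=> x xx; have [e [z [ee xz xJ]]] := drazin_Jac_idem x; exists e => //.
have -> : e - x = - (z * (x * x - x) + x * (1 - e)).
  by rewrite -xz; ring.
by rewrite rpredN rpredD //; apply: JacMl.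
Qed.

(** If g - g' is in the radical, then so is the idempotent g (1 - g'), which therefore vanishes. *)
Lemma com_idem_eq_Jac (e e' : A) :
  e * e = e -> e' * e' = e' -> pi_Jac e = pi_Jac e' -> e = e'.
Proof.
have half (g g' : A) : g * g = g -> g' * g' = g' -> g - g' \in Jac A -> g = g * g'.
  move=> gg gg' gJ; apply/eqP; rewrite -subr_eq0 -{1}[g]mulr1 -mulrBr.
  apply/eqP/Jac_idem; last by rewrite mulrBr mulr1 -{1}gg -mulrBr; apply: JacMl.
  rewrite mulrACA gg; congr (g * _).
  by rewrite mulrBr mulr1 mulrBl mul1r gg' subrr subr0.
move=> ee ee' /eq_pi_Jac J; rewrite (half e e') // mulrC -half //.
by rewrite -opprB rpredN.
Qed.

Lemma pi_Jac_com (x y : quot_Jac A) : x * y = y * x.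
Proof.
have [a <-] := pi_Jac_surj x; have [b <-] := pi_Jac_surj y.
by rewrite -!rmorphM mulrC.
Qed.

Hypothesis dccA : dcc_idempotents A.

(** Otherwise every idempotent e with image in I extends to a larger e + g, with g the idempotent
    attached to some (1 - e) x. The complements 1 - e_n then contradict [dccA]. *)
Lemma com_ideal_idem (I : set (quot_Jac A)) : right_ideal I ->
  exists e : A, [/\ e * e = e, I (pi_Jac e) & forall y, I y -> pi_Jac e * y = y].
Proof.
move=> rI; have [I0 IB Ir] := rI; apply: contrapT => nI.
pose X := {e : A | e * e = e /\ I (pi_Jac e)}.
have step (e : X) : {e' : X | sval e * sval e' = sval e /\ sval e' <> sval e}.
  apply: cid; case: e => e [ee Ie] /=; apply: contrapT => emax.
  apply: nI; exists e; split=> // y Iy; have [x xy] := pi_Jac_surj y.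
  pose a := (1 - e) * x; have [g [z [gg az aJ]]] := drazin_Jac_idem a.
  have eg : e * g = 0.
    by rewrite -az /a mulrA (mulrA e) mulrBr mulr1 ee subrr !mul0r.
  have Ia : I (pi_Jac a).
    rewrite /a mulrBl mul1r rmorphB rmorphM /= xy; apply: IB => //.
    by rewrite pi_Jac_com; apply: Ir.
  have Ig : I (pi_Jac g) by rewrite -az rmorphM /=; apply: Ir.
  have e'e : (e + g) * (e + g) = e + g.
    by rewrite mulrDr !mulrDl ee gg eg (mulrC g) eg addr0 add0r.
  have Ie' : I (pi_Jac (e + g)).
    by rewrite rmorphD /=; apply: right_idealD.
  have [g0|g0] := eqVneq g 0; last first.
    case: emax; exists (exist _ (e + g) (conj e'e Ie')) => /=; split.
      by rewrite mulrDr ee eg addr0.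
    by move=> /eqP; rewrite -subr_eq0 addrC addKr (negPf g0).
  (* If g = 0, then (1 - e) x is in the radical and the image of e already fixes y. *)
  move/pi_Jac_eq0: aJ; rewrite g0 subr0 mulr1 /a rmorphM rmorphB rmorph1 /= xy.
  by move=> /eqP; rewrite mulrBl mul1r subr_eq0 => /eqP <-.
have X0 : X by exists 0; rewrite mulr0 rmorph0.
have [e [_ eS]] := dependent_choice step X0.
pose d n := 1 - sval (e n).
have ed n : sval (e n) * sval (e n) = sval (e n) by case: (svalP (e n)).
have eeS n : sval (e n) * sval (e n.+1) = sval (e n) by have [] := eS n.
have [n|n|n|n dn] := dccA (e := d).
- by rewrite /d mulrBr mulr1 mulrBl mul1r ed subrr subr0.
- by rewrite /d mulrBr mulr1 mulrBl mul1r eeS opprB addrA subrK.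
- by rewrite /d mulrC mulrBr mulr1 mulrBl mul1r eeS opprB addrA subrK.
have [_] := eS n; apply; have := dn n.+1 (leqnSn n).
by move/addrI/oppr_inj.
Qed.

Lemma com_semiperfect : semiperfect A.
Proof.
split; last exact: com_idempotents_lift.
split=> [I rI|I rI IS].
  have [e [ee Ie eI]] := com_ideal_idem rI; have [I0 IB Ir] := rI.
  exists (range (fun x => pi_Jac (1 - e) * x)); split.
  - exact: right_ideal_principal.
  - apply/seteqP; split=> [x [Ix [y _ yx]]|x ->].
      rewrite /= -(eI _ Ix) -yx mulrA -rmorphM mulrBr mulr1 ee subrr.
      by rewrite rmorph0 mul0r.
    by split=> //; exists 0; rewrite ?mulr0.
  - move=> x; exists (pi_Jac e * x); first exact: Ir.
    exists (pi_Jac (1 - e) * x); first by exists x.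
    by rewrite -mulrDl -rmorphD addrC subrK rmorph1 mul1r.
(* The generating idempotents of a descending chain descend in A itself, since idempotents congruent
   modulo the radical are equal. *)
have [e eP] := choice (fun n => com_ideal_idem (rI n)).
have ee n : e n * e n = e n by have [] := eP n.
have eS n : e n * e n.+1 = e n.+1.
  apply: com_idem_eq_Jac => //; first by rewrite mulrACA !ee.
  have [_ _ enI] := eP n; have [_ enSI _] := eP n.+1.
  by rewrite rmorphM /= enI //; apply: IS.
have [||n|n nE] := dccA (e := e) => //; first by rewrite mulrC.
exists n => m /nE emn; have [_ Im mI] := eP m; have [_ In nI] := eP n.
rewrite emn in Im mI; have [_ _ Imr] := rI m; have [_ _ Inr] := rI n.
apply/seteqP; split=> x Ix; first by rewrite -(mI x Ix); apply: Inr.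
by rewrite -(nI x Ix); apply: Imr.
Qed.

End Commutative.

Lemma semicentral_semiperfect (A : comPzRingType) (R : pzRingType)
    (f : {rmorphism A -> R}) (B : set (set A)) :
  injective f -> semilocal R -> separating B -> drazin_ring B -> semiperfect A.
Proof.
move=> fI slR sepB AB; apply: (com_semiperfect sepB AB).
exact/(dcc_idempotents_inj fI)/semilocal_dcc_idempotents.
Qed.

End Semilocal.

(** * Perfect rings *)

Section Perfect.

(** [iteri] puts new factors on the left. A general ideal [J] allows the use of Jac(R) inside the
    opposite ring. *)
Lemma T_nilpotent_right_pi_regular (R : pzRingType) (J : set R) :
  ideal J ->
  (forall x, (forall i, J (x i)) ->
     exists n, iteri n (fun i p => x i * p) 1 = 0) ->
  (forall a, exists n z, J (a ^+ n.+1 - a ^+ n.+1 * a ^+ n.+1 * z)) ->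
  right_pi_regular R.
Proof.
move=> [rJ Jl] Tnil JR a; have [J0 JB Jr] := rJ; have [n [z az]] := JR a.
set p := a ^+ n.+1 in az.
(* The exponent grows with k so that this factor times p^k - p^(k+1) w has the form p^(k+1) -
   p^(k+2) w'. *)
have pJ k : J (p - p ^+ k.+2 * z ^+ k.+1).
  elim: k => [|k IH]; first by [].
  rewrite -[p - _](subrKA (p ^+ k.+2 * z ^+ k.+1)); apply: right_idealD => //.
  have -> : p ^+ k.+2 * z ^+ k.+1 - p ^+ k.+3 * z ^+ k.+2 =
            p ^+ k.+1 * (p - p * p * z) * z ^+ k.+1.
    rewrite mulrBr mulrBl exprSr; congr (_ - _).
    by rewrite [z ^+ k.+2]exprS [p ^+ k.+3]exprSr [p ^+ k.+2]exprSr !mulrA.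
  by apply/Jr/Jl.
have [k] := Tnil _ pJ.
(* Every defect d k = p^k - p^(k+1) w yields a next one, which has an additional
   left factor in J; T-nilpotence makes one of them vanish. *)
pose d j := iteri j (fun i q => (p - p ^+ i.+2 * z ^+ i.+1) * q) 1.
have [w dw] : exists w, d k = p ^+ k - p ^+ k.+1 * w.
  elim: k => [|k [w dw]]; first by exists 0; rewrite mulr0 subr0.
  exists (w + z ^+ k.+1 * d k).
  rewrite -[LHS]/((p - p ^+ k.+2 * z ^+ k.+1) * d k) mulrBl {1}dw.
  by rewrite mulrBr mulrA -!exprS mulrDr opprD addrA mulrA.
rewrite -[iteri _ _ _]/(d k) dw => /eqP; rewrite subr_eq0 => /eqP {}dw.
exists (n.+1 * k)%N, (a ^+ n * w).
by rewrite mulrA -exprD addSnnS -mulnSr !exprM.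
Qed.

Lemma semilocal_quot_right_pi_regular (R : pzRingType) :
  semilocal R -> right_pi_regular (quot_Jac R).
Proof.
move=> [_ artR]; apply/pi_regularP => a.
apply: artR => n; first exact: right_ideal_principal.
by move=> _ [x _ <-]; exists (a * x) => //; rewrite exprSr mulrA.
Qed.

Lemma ideal_Jac (R : pzRingType) : ideal [set x | x \in Jac R].
Proof.
split=> [|r x]; last exact: JacMl.
split=> [|x y|x r]; [exact: rpred0 | exact: rpredB | exact: JacMr].
Qed.

Lemma right_perfect_pi_regular (R : pzRingType) :
  right_perfect R -> right_pi_regular R.
Proof.
move=> [slR TR]; apply: (T_nilpotent_right_pi_regular (ideal_Jac R)).
  move=> x xJ; have [N NE] := TR x xJ; exists N.+1; rewrite -(NE N (leqnn N)).
  elim: N {NE} => [|N IH]; first by rewrite big_ord1 /= mulr1.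
  by rewrite big_ord_recl [in RHS]/= subn0 -IH.
move=> a; have [n [y]] := right_pi_regular_sqr (pi_Jac a)
  (semilocal_quot_right_pi_regular slR).
have [z <-] := pi_Jac_surj y => az; exists n, z.
by apply/eq_pi_Jac; move: az; rewrite -rmorphXn -!rmorphM.
Qed.

(** Argue in the opposite ring. Dischinger's theorem serves twice: for the left-hand condition in
    R/Jac(R), and to return to R. *)
Lemma left_perfect_pi_regular (R : pzRingType) :
  left_perfect R -> right_pi_regular R.
Proof.
move=> [slR TR].
suff RcP : right_pi_regular R^c.
  move=> a; have [n [y ay]] := right_pi_regular_left (a : R^c) RcP.
  rewrite revrX in ay; exists n.+1, (a ^+ n * (y : R)).
  by rewrite mulrA -exprD addSnnS exprD; apply: ay.
have [[J0 JB Jr] Jl] := ideal_Jac R.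
apply: (@T_nilpotent_right_pi_regular R^c [set x | x \in Jac R]).
- by split=> [|r x Jx]; [split=> // x r Jx; apply: Jl | apply: Jr].
- move=> x xJ; have [N NE] := TR x xJ; exists N.+1; rewrite -(NE N (leqnn N)).
  elim: N {NE} => [|N IH]; first by rewrite big_ord1 /= mulr1.
  by rewrite big_ord_recr -IH.
- move=> a; have [n [y]] := right_pi_regular_left (pi_Jac (a : R))
  (semilocal_quot_right_pi_regular slR).
have [z <-] := pi_Jac_surj y => az; exists n, z.
apply/eq_pi_Jac; rewrite revrX.
rewrite -[X in _ = pi_Jac X]/((z : R) * ((a : R) ^+ n.+1 * (a : R) ^+ n.+1)).
by move: az; rewrite -rmorphXn -!rmorphM.
Qed.

Lemma Jac_nilpotent_right_T (R : pzRingType) :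
  Jac_nilpotent R -> right_T_nilpotent_Jac R.
Proof.
move=> [N NE] x xJ; exists N => n Nn.
rewrite -(big_mkord xpredT (fun i => x (n - i)%N)).
rewrite (@big_cat_nat _ _ _ N) ?leqW //= big_mkord.
by rewrite (NE (fun i => x (n - i)%N)) ?mul0r.
Qed.

End Perfect.

(** * Nilpotence of the radical of a commutative ring inside a semilocal ring *)

Section CommutativeTNilpotent.
Variables (A : comPzRingType) (R : pzRingType) (f : {rmorphism A -> R}).

(** By commutativity this one condition yields both the left and the right version. *)
Definition T_nilpotent_Jac_com := forall x : nat -> A,
  (forall i, x i \in Jac A) -> exists n, \prod_(i < n) x i = 0.

Lemma T_nilpotent_com_left : T_nilpotent_Jac_com -> left_T_nilpotent_Jac A.
Proof.
move=> TA x xJ; have [N NE] := TA x xJ; exists N => n Nn.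
by rewrite -(big_mkord xpredT) (@big_cat_nat _ _ _ N) ?leqW //= big_mkord NE mul0r.
Qed.

Lemma T_nilpotent_com_right : T_nilpotent_Jac_com -> right_T_nilpotent_Jac A.
Proof.
move=> TA x xJ; have [N NE] := T_nilpotent_com_left TA xJ; exists N => n Nn.
rewrite -(NE n Nn) (reindex_inj rev_ord_inj) /=; apply: eq_bigr => i _.
by rewrite subSS subKn // -ltnS.
Qed.

Hypotheses (fI : injective f) (slR : semilocal R).
Hypothesis nilA : forall x, x \in Jac A -> exists n, x ^+ n = 0.

Let phi (x : A) := pi_Jac (f x).

(** The right ideals generated by the phi(P_n) stabilize, so phi(P_n) = phi(x_n) phi(P_n) r =
    phi(x_n)^k phi(P_n) r^k, which is zero for large k as x_n is nilpotent. *)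
Lemma prod_Jac_eventually (x : nat -> A) : (forall i, x i \in Jac A) ->
  exists n, phi (\prod_(i < n) x i) = 0.
Proof.
move=> xJ; have [_ artR] := slR; pose P n := \prod_(i < n) x i.
have PS n : P n.+1 = P n * x n by rewrite /P big_ord_recr.
have phiM a b : phi (a * b) = phi a * phi b by rewrite /phi !rmorphM.
have [n|n|n nE] := artR (fun n => range (fun r => phi (P n) * r)).
- exact: right_ideal_principal.
- by move=> _ [r _ <-]; exists (phi (x n) * r); rewrite // mulrA -phiM -PS.
exists n; rewrite -/(P n).
have : range (fun r => phi (P n.+1) * r) (phi (P n)).
  by rewrite nE //; exists 1; rewrite ?mulr1.
case=> r _ /=; rewrite PS mulrC phiM => Pr.
have Pk k : phi (P n) = phi (x n) ^+ k * phi (P n) * r ^+ k.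
  elim: k => [|k IH]; first by rewrite mul1r mulr1.
  by rewrite {1}IH -{1}Pr exprSr exprS !mulrA.
have [k xk] := nilA (xJ n).
by rewrite (Pk k) /phi -!rmorphXn xk !rmorph0 !mul0r.
Qed.

(** [T W] is the right ideal generated by phi(Jac A) W. Its iterates [V n] descend and stabilize.
    Were the stable one nonzero, dependent choice would build a sequence in Jac(A) whose products
    never kill it, against [prod_Jac_eventually]. *)
Lemma prod_Jac_uniform : exists N, forall x : nat -> A,
  (forall i, x i \in Jac A) -> phi (\prod_(i < N) x i) = 0.
Proof.
have [_ artR] := slR.
pose T (W : set (quot_Jac R)) := [set r | forall I, right_ideal I ->
  (forall x v, x \in Jac A -> W v -> I (phi x * v)) -> I r].
pose V n := iter n T setT.
have phiM a b : phi (a * b) = phi a * phi b by rewrite /phi !rmorphM.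
have TW W x v : x \in Jac A -> W v -> T W (phi x * v).
  by move=> xJ Wv I rI; apply.
have rT W : right_ideal (T W).
  split=> [I [] //|x y Wx Wy I rI WI|x r Wx I rI WI].
    by have [_ IB _] := rI; apply: IB; [apply: Wx | apply: Wy].
  by have [_ _ Ir] := rI; apply: Ir; apply: Wx.
have [n|n|n nE] := artR V.
- by case: n => [|n]; [split | apply: rT].
- elim: n => // n IH r Vr I rI WI; apply: Vr => // x v xJ /IH; exact: WI.
have {}nE : V n.+1 = V n by apply: nE.
have phiV (x : nat -> A) k : (forall i, x i \in Jac A) -> V k (phi (\prod_(i < k) x i)).
  move=> xJ; elim: k => // k IH; rewrite big_ord_recr /= mulrC phiM.
  exact: TW.
suff V0 v : V n v -> v = 0 by exists n => x xJ; apply/V0/phiV.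
move=> Vv; apply: contrapT => v0.
pose X := {p : A | exists2 v, V n v & phi p * v <> 0}.
have step (p : X) : {q : X | exists2 x, x \in Jac A & sval q = sval p * x}.
  apply: cid; case: p => p [w Vw pw] /=; apply: contrapT => nX; apply: pw.
  move: Vw; rewrite -nE => Vw.
  apply: (Vw [set r | phi p * r = 0]).
    split=> /= [|x y px py|x r px]; first by rewrite mulr0.
      by rewrite mulrBr px py subrr.
    by rewrite mulrA px mul0r.
  move=> x u xJ Vu; apply: contrapT => /= pxu; apply: nX.
  rewrite mulrA -phiM in pxu.
  by exists (exist _ (p * x) (ex_intro2 _ _ u Vu pxu)); exists x.
have X0 : exists2 u, V n u & phi 1 * u <> 0.
  by exists v => //; rewrite /phi !rmorph1 mul1r.
have [p [p0 pS]] := dependent_choice step (exist _ 1 X0).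
have [x xE] := choice (fun k => let: ex_intro2 x xJ xE := pS k in
  ex_intro (fun x => x \in Jac A /\ sval (p k.+1) = sval (p k) * x) x (conj xJ xE)).
have [|k] := @prod_Jac_eventually x; first by move=> i; have [] := xE i.
have -> : \prod_(i < k) x i = sval (p k).
  elim: k => [|k IH]; first by rewrite big_ord0 p0.
  by rewrite big_ord_recr /= IH; have [] := xE k.
by have [u Vu pu] := svalP (p k) => pk; apply: pu; rewrite pk mul0r.
Qed.

(** The M N factors are grouped into M blocks of length N, each of which f sends into Jac(R). *)
Lemma Jac_nilpotent_com : Jac_nilpotent R -> Jac_nilpotent A.
Proof.
move=> [M ME]; have [N NE] := prod_Jac_uniform; exists (M * N)%N => x xJ.
rewrite -(big_mkord xpredT x) big_nat_mul big_mkord; apply: fI.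
rewrite rmorph0 rmorph_prod.
apply: (ME (fun i => f (\prod_(i * N <= j < i.+1 * N) x j))).
move=> i; apply/pi_Jac_eq0.
rewrite -{1}[(i * N)%N]add0n mulSn big_addn addnK big_mkord.
exact: (NE (fun j => x (j + i * N)%N)).
Qed.

(** The cut points [s k] give consecutive blocks with products in Jac(R); the hypothesis applies to
    the sequence of blocks. *)
Lemma T_nilpotent_com :
  (forall y : nat -> A, (forall i, f (y i) \in Jac R) ->
     exists n, \prod_(i < n) y i = 0) -> T_nilpotent_Jac_com.
Proof.
move=> TR x xJ.
have /choice[l lE] m : exists l, phi (\prod_(m <= i < m + l) x i) = 0.
  have [l lE] := @prod_Jac_eventually (fun i => x (i + m)%N) (fun i => xJ _).
  by exists l; rewrite -{1}[m]add0n big_addn addKn big_mkord.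
pose s k := iter k (fun m => m + l m)%N 0%N.
have [|n nE] := TR (fun k => \prod_(s k <= i < s k.+1) x i).
  by move=> i; apply/pi_Jac_eq0/lE.
exists (s n); rewrite -nE -(big_mkord xpredT x).
elim: n {nE} => [|n IH]; first by rewrite big_ord0 big_geq.
by rewrite big_ord_recr /= -IH -big_cat_nat //= leq_addr.
Qed.

End CommutativeTNilpotent.

(** * Transfer of the discrete properties *)

Section DiscreteProperties.

Lemma satisfies_disc_pi_regular Q (R : pzRingType) :
  satisfies_disc Q R -> pi_regular R.
Proof.
case: Q => /=; rewrite ?pi_regularP.
- move=> [slR NR]; apply: right_perfect_pi_regular; split=> //.
  exact: Jac_nilpotent_right_T.
- exact: right_perfect_pi_regular.
- exact: left_perfect_pi_regular.
- by move=> [/pi_inf_regularW/pi_regularP].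
- by move=> /pi_inf_regularW/pi_regularP.
- by case.
- by [].
Qed.

(** In x^n (1 - x z) = 0 the second factor is right invertible. *)
Lemma pi_regular_nil_Jac (R : pzRingType) : pi_regular R ->
  forall x, x \in Jac R -> exists n, x ^+ n = 0.
Proof.
move=> /pi_regularP/right_pi_regular_drazin RD x xJ.
have [z [_ _ /(_ _ erefl)[n xn]]] := RD x; exists n.
have [y zy] := Jac_right_inv z xJ.
by rewrite -[x ^+ n]mulr1 -zy mulrA xn mul0r.
Qed.

Lemma semicentral_satisfies_disc Q (A : comPzRingType) (R : pzRingType)
    (f : {rmorphism A -> R}) :
  semicentral (zero_ideal R) f -> satisfies_disc Q R -> satisfies_disc Q A.
Proof.
move=> fC RQ; have fI : injective f by case: fC.
have piA : pi_regular A.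
  exact/(semicentral_pi_regular fC)/(satisfies_disc_pi_regular RQ).
have nilA := pi_regular_nil_Jac piA.
have spA : semilocal R -> semiperfect A.
  move=> slR; apply: (semicentral_semiperfect fI slR (separating_zero_ideal A)).
  exact/right_pi_regular_drazin/pi_regularP.
have TA : semilocal R ->
    (forall y : nat -> A, (forall i, f (y i) \in Jac R) ->
     exists n, \prod_(i < n) y i = 0) -> T_nilpotent_Jac_com A.
  by move=> slR; apply: T_nilpotent_com.
case: Q RQ => /=.
- move=> [slR NR]; split; first by have [] := spA slR.
  exact: Jac_nilpotent_com fI slR nilA NR.
- move=> [slR TR]; split; first by have [] := spA slR.
  apply/T_nilpotent_com_right/(TA slR) => y yJ.
  have [N NE] := TR _ yJ; exists N.+1; apply: fI.
  (* The factors are reversed in the commutative ring A, before f is distributed over the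
     product. *)
  rewrite rmorph0 -(NE N (leqnn N)) (reindex_inj rev_ord_inj) rmorph_prod.
  apply: eq_bigr => i _.
  by rewrite /= subSS.
- move=> [slR TR]; split; first by have [] := spA slR.
  apply/T_nilpotent_com_left/(TA slR) => y yJ.
  have [N NE] := TR _ yJ; exists N.+1; apply: fI.
  by rewrite rmorph0 -(NE N (leqnn N)) rmorph_prod.
- move=> [piR [slR _]]; split; last exact: spA.
  exact: semicentral_pi_inf_regular fC piR.
- exact: semicentral_pi_inf_regular fC.
- by move=> [_ [slR _]]; split; last exact: spA.
- by [].
Qed.

End DiscreteProperties.

(** * Linear topologies *)

Section IdealTopology.

(** The last clause determines [tau] by [B], so that topological conditions become conditions on the
    family used in [drazin_ring]. *)
Definition ideal_basis (R : pzRingType) (tau : topology_on R) (B : set (set R)) :=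
  [/\ forall I, B I -> ideal I, exists I, B I,
      forall I J, B I -> B J -> exists2 K, B K & K `<=` I `&` J &
      forall U, opens tau U <->
        forall x, U x -> exists2 I, B I & forall y, I y -> U (x + y)].

Section Basis.
Variables (R : pzRingType) (tau : topology_on R) (B : set (set R)).
Hypothesis tauB : ideal_basis tau B.

Lemma ideal_basis_nbhs (x : topologize tau) U : nbhs x U <->
  exists2 I, B I & forall y, I y -> U (x + y).
Proof.
have [idB _ _ oB] := tauB; rewrite nbhsE; split=> [[V [oV Vx] VU]|[I BI IU]].
  have [I BI IV] := (oB V).1 oV x Vx; exists I => // y Iy; exact/VU/IV.
have [rI _] := idB I BI; have [I0 _ _] := rI.
exists [set y | I (y - x)]; last first.
  by move=> y /= Iy; rewrite -[y](subrK x) addrC; apply: IU.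
split; last by rewrite /= subrr.
apply/(oB _) => y /= Iy; exists I => // z Iz.
by rewrite addrAC; apply: right_idealD.
Qed.

Lemma ideal_basis_linear : linear_ring_topology tau.
Proof.
have [idB BN _ oB] := tauB.
have mulE (x y z t : R) : z * t = x * y + ((z - x) * t + x * (t - y)).
  have -> : (z - x) * t + x * (t - y) = z * t - x * y.
    by rewrite mulrBl mulrBr addrA subrK.
  by rewrite addrC subrK.
split.
- move=> [x y] U /ideal_basis_nbhs[I BI IU]; have [rI _] := idB I BI.
  exists ([set z | I (z - x)], [set z | I (z - y)]) => /=; last first.
    move=> [z t] /= [Iz It]; rewrite -[z](subrK x) -[t](subrK y) addrACA addrC.
    by apply: IU; apply: right_idealD.
  by split; apply/ideal_basis_nbhs; exists I => // z Iz /=; rewrite addrC addKr.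
- move=> x U /ideal_basis_nbhs[I BI IU]; have [rI _] := idB I BI.
  apply/ideal_basis_nbhs; exists I => // y Iy /=; rewrite opprD.
  by apply: IU; apply: right_idealN.
- move=> [x y] U /ideal_basis_nbhs[I BI IU].
  have [rI Il] := idB I BI; have [_ _ Ir] := rI.
  exists ([set z | I (z - x)], [set z | I (z - y)]) => /=; last first.
    move=> [z t] /= [Iz It]; suff : U (z * t) by [].
    rewrite (mulE x y z t).
    by apply: IU; apply: right_idealD => //; [apply: Ir | apply: Il].
  by split; apply/ideal_basis_nbhs; exists I => // z Iz /=; rewrite addrC addKr.
- move=> U /ideal_basis_nbhs[I BI IU]; have iI := idB I BI.
  exists I; split=> //; last by move=> x /IU; rewrite add0r.
  by apply/ideal_basis_nbhs; exists I => // y Iy; rewrite add0r.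
Qed.

Lemma ideal_basis_hausdorff : separating B -> hausdorff_space (topologize tau).
Proof.
move=> [idB sepB] p q pq; apply/eqP; rewrite -subr_eq0; apply/eqP/sepB => I BI.
have [rI _] := idB I BI.
have [||y [/= Iy Iy']] := pq [set y | I (y - p)] [set y | I (y - q)].
- by apply/ideal_basis_nbhs; exists I => // z Iz /=; rewrite addrC addKr.
- by apply/ideal_basis_nbhs; exists I => // z Iz /=; rewrite addrC addKr.
have [_ IB _] := rI; have := IB _ _ Iy' Iy.
by rewrite opprB addrC subrKA.
Qed.

Lemma hausdorff_separating : hausdorff_space (topologize tau) -> separating B.
Proof.
move=> hR; have [idB _ _ _] := tauB; split=> // x xB.
suff : (0 : topologize tau) = x by move=> <-.
apply: hR => U V /ideal_basis_nbhs[I BI IU] /ideal_basis_nbhs[J BJ JV].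
exists 0; split; first by rewrite -[0]addr0; apply: IU; have [[]] := idB I BI.
rewrite -(subrr x); apply: JV; apply: right_idealN; last exact: xB.
by have [] := idB J BJ.
Qed.

Lemma opens_mx n (U : set 'M[R]_n) : opens (mx_topology tau n) U <->
  forall A, U A -> exists I : set R,
    [/\ ideal I, opens tau I &
        forall M : 'M[R]_n, (forall i j, I (M i j)) -> U (A + M)].
Proof. by split; apply. Qed.

Lemma ideal_basis_mx n : ideal_basis (mx_topology tau n) (mx_ideals n B).
Proof.
have [idB [I0 BI0] dirB oB] := tauB; split.
- by move=> _ [I BI <-]; apply/ideal_mx/idB.
- by exists [set M : 'M[R]_n | forall i j, I0 (M i j)]; exists I0.
- move=> _ _ [I BI <-] [J BJ <-]; have [K BK KIJ] := dirB I J BI BJ.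
  exists [set M : 'M[R]_n | forall i j, K (M i j)]; first by exists K.
  by move=> M KM; split=> i j; have [] := KIJ _ (KM i j).
move=> U; rewrite opens_mx; split=> [oU M /oU[I [iI oI IU]]|UB M UM].
  have [[I_0 _ _] _] := iI; have [J BJ JI] := (oB I).1 oI 0 I_0.
  exists [set M : 'M[R]_n | forall i j, J (M i j)]; first by exists J.
  by move=> N JN; apply: IU => i j; rewrite -[N i j]add0r; apply: JI.
have [_ [I BI <-] IU] := UB M UM; exists I; split=> //; first exact: idB.
apply/oB => x Ix; exists I => // y Iy.
by apply: right_idealD => //; have [] := idB I BI.
Qed.

(** The inverse of e a e in the corner e R e is a Drazin inverse of a. Conversely take e = a z; then
    (f a f)^k = a^k f for k > 0, which tends to 0. *)
Lemma quasi_pi_regularP :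
  quasi_pi_regular tau <-> separating B /\ drazin_ring B.
Proof.
have [idB _ _ _] := tauB; split=> [[_ hR RP]|[sepB RB]].
  split=> [|a]; first exact: hausdorff_separating.
  have [e [b [f [fE ee aE [bE ab ba] aN]]]] : exists e b f : R,
      [/\ f = 1 - e, e * e = e, a = e * a * e + f * a * f,
          [/\ b = e * b * e, e * a * e * b = e & b * (e * a * e) = e] &
          forall U : set R, nbhs (0 : topologize tau) U ->
            \forall k \near \oo, U ((f * a * f) ^+ k)].
    have [e [ee aE [b [bE ab ba]] aN]] := RP a.
    by exists e, b, (1 - e); split=> // U /aN.
  have fe : f * e = 0 by rewrite fE mulrBl mul1r ee subrr.
  have ef : e * f = 0 by rewrite fE mulrBr mulr1 ee subrr.
  have ff : f * f = f by rewrite {2}fE mulrBr mulr1 fe subr0.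
  have fb : f * b = 0 by rewrite bE !mulrA fe !mul0r.
  have bf : b * f = 0 by rewrite bE -!mulrA ef !mulr0.
  have abE : a * b = e by rewrite aE mulrDl ab -mulrA fb mulr0 addr0.
  have baE : b * a = e by rewrite aE mulrDr ba !mulrA bf !mul0r addr0.
  have eb : e * b = b by rewrite bE !mulrA ee.
  exists b; split; [by rewrite abE baE | by rewrite baE |].
  move=> I BI; rewrite abE -fE; have [[_ _ Ir] Il] := idB I BI.
  have [N _ NI] : \forall k \near \oo, I ((f * a * f) ^+ k).
    by apply: aN; apply/ideal_basis_nbhs; exists I => // y Iy; rewrite add0r.
  (* The exponent must be positive: for exponent 0 the two sides are f and 1. *)
  exists N.+1; suff -> : a ^+ N.+1 * f = (f * a * f) ^+ N.+1 by apply: NI => /=.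
  have af : a * f = f * a * f.
    by rewrite {1}aE mulrDl -!mulrA ef ff !mulr0 add0r !mulrA.
  have faf : f * (f * a * f) = f * a * f by rewrite !mulrA ff.
  elim: N {NI} => [|N IH]; first by rewrite !expr1.
  by rewrite exprSr -mulrA af -{1}faf mulrA IH -exprSr.
split; [exact: ideal_basis_linear | exact: ideal_basis_hausdorff |].
move=> a; have [z az] := RB a; have [azC zaz azB] := az; exists (a * z).
set e := a * z in azB *; set f := 1 - e in azB *.
have ee : e * e = e by apply: drazin_idem az.
have ae : a * e = e * a by have := drazinXC 1 az; rewrite expr1.
have fe : f * e = 0 by rewrite mulrBl mul1r ee subrr.
have ef : e * f = 0 by rewrite mulrBr mulr1 ee subrr.
have ff : f * f = f by rewrite {2}/f mulrBr mulr1 fe subr0.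
have af : a * f = f * a by rewrite mulrBr mulrBl mul1r mulr1 ae.
have ez : e * z = z by rewrite /e azC.
have ze : z * e = z by rewrite mulrA.
have eae : e * a * e = a * e by rewrite -mulrA ae mulrA ee.
have faf : f * a * f = a * f by rewrite -mulrA af mulrA ff.
split=> //.
- by rewrite eae faf -mulrDr addrC subrK mulr1.
- exists z; rewrite ez ze eae; split=> //; first by rewrite -mulrA ez.
  by rewrite mulrA -azC.
move=> U /ideal_basis_nbhs[I BI IU]; have [n aI] := azB I BI.
exists n.+1 => // k /= nk; rewrite faf -[X in U X]add0r; apply: IU.
have [[_ _ Ir] Il] := idB I BI.
have fX j : f ^+ j.+1 = f by elim: j => // j IH; rewrite exprS IH.
rewrite exprMn_comm //; case: k nk => // k nk.
rewrite fX -(subnK (ltnW nk)) exprD -mulrA; exact: Il.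
Qed.

End Basis.

Definition open_ideals (R : pzRingType) (tau : topology_on R) : set (set R) :=
  [set I | ideal I /\ opens tau I].

Lemma linear_ideal_basis (R : pzRingType) (tau : topology_on R) :
  linear_ring_topology tau -> ideal_basis tau (open_ideals tau).
Proof.
move=> [contD contN contM linR]; split.
- by move=> I [].
- exists setT; split; last exact: opens_setT.
  by split=> //; split.
- move=> I J [iI oI] [iJ oJ]; exists (I `&` J) => //; split; last exact: opens_setI.
  case: iI iJ => [[I0 IB IM] MI] [[J0 JB JM] MJ]; split; last first.
    by move=> r x [Ix Jx]; split; [apply: MI | apply: MJ].
  split=> //.
  + by move=> x y [Ix Jx] [Iy Jy]; split; [apply: IB | apply: JB].
  + by move=> x r [Ix Jx]; split; [apply: IM | apply: JM].
have shift (x y : topologize tau) (U : set (topologize tau)) :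
    nbhs (x + y) U -> nbhs y [set z | U (x + z)].
  move=> /(contD (x, y))[[V W] /= [Vx Wy] VW].
  apply: filterS Wy => z Wz; apply: (VW (x, z)); split=> //=.
  exact: nbhs_singleton.
(* By translation, an ideal that is a neighbourhood of 0 is a neighbourhood of each of its
   points. *)
have openI (I : set (topologize tau)) :
    ideal I -> nbhs (0 : topologize tau) I -> opens tau I.
  move=> [rI _] I0; rewrite -[opens tau I]/(open I) openE => x Ix.
  have := shift (- x) x I; rewrite addNr => /(_ I0); apply: filterS => z /= Iz.
  by rewrite -[z](addNKr x); apply: right_idealD.
move=> U; split=> [oU x Ux|UI].
  have nU : nbhs (x + 0 : topologize tau) U.
    by rewrite addr0; apply: open_nbhs_nbhs.
  have [I [iI I0 IU]] := linR _ (shift x 0 U nU).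
  by exists I => //; split=> //; apply: openI.
rewrite -[opens tau U]/(open (U : set (topologize tau))) openE => x Ux.
have [I [[rI _] oI] IU] := UI x Ux.
have I0 : nbhs (- x + x : topologize tau) I.
  by rewrite addNr; apply: open_nbhs_nbhs; split=> //; case: rI.
by apply: filterS (shift (- x) x I I0) => z /= /IU; rewrite addrA subrr add0r.
Qed.

Section IdealTopologyOf.
Variables (R : pzRingType) (B : set (set R)).
Hypotheses (idB : forall I, B I -> ideal I) (BN : exists I, B I).
Hypothesis dirB : forall I J, B I -> B J -> exists2 K, B K & K `<=` I `&` J.

Let ideal_opens : set_system R :=
  [set U | forall x, U x -> exists2 I, B I & forall y, I y -> U (x + y)].

Let ideal_opens_setT : ideal_opens setT.
Proof. by move=> x _; have [I BI] := BN; exists I. Qed.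

Let ideal_opens_setI : setI_closed ideal_opens.
Proof.
move=> U V oU oV x [/oU[I BI IU] /oV[J BJ JV]].
have [K BK KIJ] := dirB BI BJ; exists K => // y /KIJ[Iy Jy].
by split; [apply: IU | apply: JV].
Qed.

Let ideal_opens_bigcup (K : Type) (f : K -> set R) :
  (forall i, ideal_opens (f i)) -> ideal_opens (\bigcup_i f i).
Proof.
move=> of_ x [k _ /of_[I BI If]].
by exists I => // y Iy; exists k => //; apply: If.
Qed.

Definition ideal_topology : topology_on R :=
  TopologyOn ideal_opens_setT ideal_opens_setI ideal_opens_bigcup.

Lemma ideal_topology_basis : ideal_basis ideal_topology B.
Proof. by split. Qed.

End IdealTopologyOf.

End IdealTopology.

(** * Inverse limits *)

Section InverseLimits.

Definition thread_component (A : inverse_system) (i : Defs.index A)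
  (x : inverse_limit A) : obj i := (val x : prod_ring (@obj A)) i.

Definition thread_kernels (A : inverse_system) : set (set (inverse_limit A)) :=
  range (fun i : Defs.index A => thread_component i @^-1` [set 0]).

Section Limit.
Variable A : inverse_system.
Implicit Types x y : inverse_limit A.

Lemma trans_thread x (i j : Defs.index A) (ij : (i <= j)%O) :
  trans ij (thread_component j x) = thread_component i x.
Proof. exact: (elimT (threadP _) (valP x)). Qed.

Lemma thread_component_ext x y :
  (forall i, thread_component i x = thread_component i y) -> x = y.
Proof.
by move=> xy; apply: val_inj; apply/functional_extensionality_dep => i; apply: xy.
Qed.

Section Component.
Variable i : Defs.index A.
Fact thread_component_zmod_morphism : zmod_morphism (thread_component i).
Proof. by []. Qed.
HB.instance Definition _ := GRing.isZmodMorphism.Build (inverse_limit A) (obj i)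
  (thread_component i) thread_component_zmod_morphism.
Fact thread_component_monoid_morphism : monoid_morphism (thread_component i).
Proof. by []. Qed.
HB.instance Definition _ := GRing.isMonoidMorphism.Build (inverse_limit A) (obj i)
  (thread_component i) thread_component_monoid_morphism.
End Component.

Lemma ideal_thread_kernel (i : Defs.index A) :
  ideal (thread_component (A := A) i @^-1` [set 0]).
Proof. exact/ideal_preim/(separating_zero_ideal _).1. Qed.

Lemma separating_thread_kernels : separating (thread_kernels (A := A)).
Proof.
split=> [_ [i _ <-]|x x0]; first exact: ideal_thread_kernel.
apply: thread_component_ext => i; rewrite rmorph0.
by apply: (x0 (thread_component i @^-1` [set 0])); exists i.
Qed.

Lemma thread_kernels_directed I J :
  thread_kernels I -> thread_kernels J ->
  exists2 K, thread_kernels (A := A) K & K `<=` I `&` J.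
Proof.
move=> [i _ <-] [j _ <-]; have [k /andP[ik jk]] := index_directed i j.
exists (thread_component k @^-1` [set 0]); first by exists k.
by move=> x /= xk; rewrite -(trans_thread x ik) -(trans_thread x jk) xk !rmorph0.
Qed.

(** By uniqueness the Drazin inverses of the components are compatible with the transition maps. The
    exponents may vary with i, hence the family of kernels. *)
Lemma inverse_limit_drazin :
  (forall i : Defs.index A, pi_regular (obj i)) ->
  drazin_ring (thread_kernels (A := A)).
Proof.
move=> piA a.
have zP i : {z | drazin (zero_ideal _) (thread_component i a) z}.
  apply: cid.
  exact: (iffLR (right_pi_regular_drazin _) (iffLR (pi_regularP _) (piA i))).
pose z i := sval (zP i); have zE i := svalP (zP i).
have zT : (z : prod_ring (@obj A)) \in @thread A.
  apply/threadP => i j ij.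
  apply: (drazin_uniq (separating_zero_ideal _)) (zE i).
  rewrite -(trans_thread a ij); apply: drazin_morph (zE j) => _ ->.
  by exists [set 0] => // x -> /=; rewrite rmorph0.
exists (exist (fun x : prod_ring (@obj A) => x \in @thread A) z zT); split.
- by apply: thread_component_ext => i; have [] := zE i.
- by apply: thread_component_ext => i; have [] := zE i.
move=> _ [i _ <-]; have [_ _ /(_ _ erefl)[n an]] := zE i; exists n.
by rewrite /preimage /= rmorphM rmorphXn.
Qed.

End Limit.

(** The empty index type imposes no commutation condition. *)
Lemma bij_semicentral (A R : pzRingType) (f : {rmorphism A -> R}) g B :
  cancel f g -> cancel g f -> semicentral B f.
Proof.
move=> fK gK.
apply: (@Semicentral _ _ _ _ False (fun=> R) (fun=> idfun) (fun=> B) (fun=> setT)).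
- exact: can_inj fK.
- by case.
- by case.
- by move=> r; split=> [_ []|_]; exists (g r).
Qed.

(** The topology is pulled back along f: the contracted thread kernels form its basis, and f becomes
    a homeomorphism. *)
Lemma iso_inverse_limit_pro (Q : pzRingType -> Prop) (R : pzRingType)
    (A : inverse_system) (f : {rmorphism R -> inverse_limit A}) g :
  (forall i, Q (@obj A i)) -> cancel f g -> cancel g f ->
  exists2 tau : topology_on R, linear_ring_topology tau & pro Q tau.
Proof.
move=> QA fK gK; have fI := can_inj fK.
pose B := preim_ideals f (thread_kernels (A := A)).
have [idB _] : separating B.
  exact: separating_preim fI (@separating_thread_kernels A).
have BN : exists I, B I.
  by have [i] := index_inhabited A; do 2![eexists]; [exists i | reflexivity].
have dirB I J : B I -> B J -> exists2 K, B K & K `<=` I `&` J.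
  move=> [I' BI <-] [J' BJ <-]; have [K BK KIJ] := thread_kernels_directed BI BJ.
  by exists (f @^-1` K); [exists K | move=> x /KIJ].
have tauB := ideal_topology_basis idB BN dirB.
exists (ideal_topology BN dirB); first exact: ideal_basis_linear tauB.
exists A => //; exists f, g; split=> //.
  apply: continuous_comp_initial => x.
  have FF : Filter ((@inverse_limit_incl A \o f) @ nbhs x).
    by apply: fmap_filter; apply: nbhs_filter.
  (* Continuity into the product is checked one component at a time; component i is constant on
     cosets of its kernel. *)
  apply/cvg_sup => i U [V [[W oW <-] Wx] VU].
  apply: (filterS VU); apply/(ideal_basis_nbhs tauB x).
  exists (f @^-1` (thread_component i @^-1` [set 0])).
    by exists (thread_component i @^-1` [set 0]) => //; exists i.
  move=> y /= fy; move: Wx; congr W.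
  by rewrite -[RHS]/(thread_component i (f (x + y))) !rmorphD /= fy addr0.
move=> y U /(ideal_basis_nbhs tauB)[_ [_ [i _ <-] <-] IU].
pose p : inverse_limit_space A -> discrete_topology (obj i) := thread_component i.
have pC : continuous p.
  move=> z; apply: (@continuous_comp (inverse_limit_space A)
    (prod_topology (fun i => discrete_topology (obj i))) (discrete_topology (obj i))
    (@inverse_limit_incl A) (@proj _ (fun i => discrete_topology (obj i)) i)).
    exact: initial_continuous.
  exact: proj_continuous.
have /pC yN : nbhs (p y) [set p y] by rewrite nbhs_principalE; apply/principal_filterP.
apply: (@filterS _ (nbhs (y : inverse_limit_space A)) (nbhs_filter _) _ _ _ yN).
move=> z /= pz; rewrite -[g z](addNKr (g y)); apply: IU.
rewrite /preimage /= rmorphD rmorphN !gK rmorphD rmorphN /=.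
by rewrite [thread_component i z]pz addNr.
Qed.
End InverseLimits.

(** * Commutative subrings as commutative rings *)

Section CommutativeSubring.
Variables (R : pzRingType) (S : subringClosed R).

(** The proof [Scomm] is kept in the type so that a commutative ring structure can be attached to
    it. *)
Definition com_subring (Scomm : commutative_subring S) : Type := subring S.

Section Structure.
Hypothesis Scomm : commutative_subring S.

Fact com_subring_mulC : commutative (@GRing.mul (subring S)).
Proof. by move=> x y; apply: val_inj; apply: Scomm; apply: valP. Qed.

HB.instance Definition _ := GRing.PzRing.copy (com_subring Scomm) (subring S).
HB.instance Definition _ :=
  GRing.PzSemiRing_hasCommutativeMul.Build (com_subring Scomm) com_subring_mulC.

End Structure.

Hypothesis Scomm : commutative_subring S.

Lemma subring_satisfies_disc Q (T : pzRingType) (f : {rmorphism subring S -> T}) :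
  semicentral (zero_ideal T) f -> satisfies_disc Q T -> satisfies_disc Q (subring S).
Proof. exact: (@semicentral_satisfies_disc Q (com_subring Scomm)). Qed.

Lemma subring_semiperfect (B : set (set (subring S))) :
  semilocal R -> separating B -> drazin_ring B -> semiperfect (subring S).
Proof.
exact: (@semicentral_semiperfect (com_subring Scomm) R
  (val : {rmorphism subring S -> R}) B val_inj).
Qed.

End CommutativeSubring.

(** * Bicommutants in an inverse system *)

Section Bicommutant.
Variables (A : inverse_system) (Y : forall i : Defs.index A, set (obj i)).

(* The plain double centralizers do not form an inverse system, since the
   transition maps need not be surjective; the condition is therefore imposed
   on all images of b. *)
Definition hereditary_bicommutant (i : Defs.index A) : {pred obj i} := fun b =>
  `[< forall k (ki : (k <= i)%O) t, (forall y, Y y -> t * y = y * t) ->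
        trans ki b * t = t * trans ki b >].

Lemma hereditary_bicommutantP i (b : obj i) :
  reflect (forall k (ki : (k <= i)%O) t, (forall y, Y y -> t * y = y * t) ->
        trans ki b * t = t * trans ki b) (b \in @hereditary_bicommutant i).
Proof. exact: asboolP. Qed.

Fact hereditary_bicommutant_closed i : subring_closed (@hereditary_bicommutant i).
Proof.
split=> [|b c /hereditary_bicommutantP bY /hereditary_bicommutantP cY|
  b c /hereditary_bicommutantP bY /hereditary_bicommutantP cY];
  apply/hereditary_bicommutantP => k ki t tY.
- by rewrite rmorph1 mul1r mulr1.
- by rewrite rmorphB mulrBl mulrBr bY // cY.
- by rewrite rmorphM -mulrA cY // !mulrA bY.
Qed.

HB.instance Definition _ i := GRing.isSubringClosed.Build (obj i)
  (@hereditary_bicommutant i) (@hereditary_bicommutant_closed i).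

Hypothesis Ycomm : forall i (y z : obj i), Y y -> Y z -> y * z = z * y.

(** The case k = i puts b in the double commutant of [Y], which is commutative because [Y] is. *)
Lemma hereditary_bicommutant_comm i :
  commutative_subring (@hereditary_bicommutant i).
Proof.
have bC (b : obj i) t : b \in @hereditary_bicommutant i ->
    (forall y, Y y -> t * y = y * t) -> b * t = t * b.
  move=> /hereditary_bicommutantP bY tY.
  by have := bY i (lexx i) t tY; rewrite trans_id.
move=> b c bB cB; apply: (bC) => // y Yy.
by apply: bC => // z Yz; apply: Ycomm.
Qed.

(** Several target rings occur here: the commutation conditions live in all [obj k] with k below
    i. *)
Lemma hereditary_bicommutant_semicentral i :
  semicentral (zero_ideal (obj i))
    (val : {rmorphism subring (@hereditary_bicommutant i) -> obj i}).
Proof.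
pose K := {k : Defs.index A | (k <= i)%O}.
apply: (@Semicentral _ _ _ _ K (fun k => obj (sval k)) (fun k => trans (proj2_sig k))
  (fun k => zero_ideal _)
  (fun k => [set t | forall y, Y y -> t * y = y * t])).
- exact: val_inj.
- by move=> k; apply: separating_zero_ideal.
- by move=> k _ ->; exists [set 0] => // x -> /=; rewrite rmorph0.
move=> b; split=> [[c <-] [k ki] t tY|bY].
  by have /hereditary_bicommutantP := valP c; apply.
have bB : b \in @hereditary_bicommutant i.
  by apply/hereditary_bicommutantP => k ki t tY; exact: (bY (exist _ k ki) t tY).
by exists (Sub b bB).
Qed.

Lemma hereditary_bicommutant_trans i j (ij : (i <= j)%O) (b : obj j) :
  b \in @hereditary_bicommutant j -> trans ij b \in @hereditary_bicommutant i.
Proof.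
move=> /hereditary_bicommutantP bY; apply/hereditary_bicommutantP => k ki t tY.
by rewrite (trans_comp ki ij (le_trans ki ij)); apply: bY.
Qed.

Definition bicommutant_trans i j (ij : (i <= j)%O)
    (b : subring (@hereditary_bicommutant j)) : subring (@hereditary_bicommutant i) :=
  Sub (trans ij (val b)) (hereditary_bicommutant_trans ij (valP b)).

Section Trans.
Variables (i j : Defs.index A) (ij : (i <= j)%O).
Fact bicommutant_trans_zmod_morphism : zmod_morphism (bicommutant_trans ij).
Proof. by move=> b c; apply: val_inj; rewrite /= rmorphB. Qed.
HB.instance Definition _ := GRing.isZmodMorphism.Build _ _
  (bicommutant_trans ij) bicommutant_trans_zmod_morphism.
Fact bicommutant_trans_monoid_morphism : monoid_morphism (bicommutant_trans ij).
Proof.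
split=> [|b c]; apply: val_inj; rewrite /=; [exact: rmorph1 | exact: rmorphM].
Qed.
HB.instance Definition _ := GRing.isMonoidMorphism.Build _ _
  (bicommutant_trans ij) bicommutant_trans_monoid_morphism.
End Trans.

Fact bicommutant_trans_id i (ii : (i <= i)%O) b : bicommutant_trans ii b = b.
Proof. by apply: val_inj; apply: trans_id. Qed.

Fact bicommutant_trans_comp i j k (ij : (i <= j)%O) (jk : (j <= k)%O)
  (ik : (i <= k)%O) b :
  bicommutant_trans ij (bicommutant_trans jk b) = bicommutant_trans ik b.
Proof. by apply: val_inj; apply: trans_comp. Qed.

Definition bicommutant_system : inverse_system :=
  @InverseSystem (index_disp A) (Defs.index A) (index_inhabited A)
    (@index_directed A) (fun i => subring (@hereditary_bicommutant i))
    (fun i j ij => bicommutant_trans ij) bicommutant_trans_id bicommutant_trans_comp.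

Lemma bicommutant_system_disc Q :
  (forall i : Defs.index A, satisfies_disc Q (obj i)) ->
  forall i : Defs.index bicommutant_system, satisfies_disc Q (obj i).
Proof.
move=> AQ i; apply: (subring_satisfies_disc (@hereditary_bicommutant_comm i)) (AQ i).
exact: hereditary_bicommutant_semicentral.
Qed.

End Bicommutant.

(** * Centralizers *)

Section Centralizer.
Variables (R : pzRingType) (S : subringClosed R) (X : set R).
Hypothesis Scomm : commutative_subring S.
Hypothesis SX : forall r, (r \in S) <-> (forall x, X x -> r * x = x * r).

Let incl : {rmorphism subring S -> R} := val.

Lemma centralizer_semicentral B : separating B -> semicentral B incl.
Proof.
move=> sepB.
apply: (@Semicentral _ _ _ _ unit (fun=> R) (fun=> idfun) (fun=> B) (fun=> X)).
- exact: val_inj.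
- by [].
- by move=> _ I BI; exists I.
move=> r; split=> [[s <-] _|rX].
  by apply/SX; apply: valP.
have rS : r \in S by apply/SX => x Xx; apply: (rX tt).
by exists (Sub r rS).
Qed.

Section Pro.
Variables (A : inverse_system) (f : {rmorphism R -> inverse_limit A}).
Variable g : inverse_limit A -> R.
Hypotheses (fK : cancel f g) (gK : cancel g f).

Definition component_image (i : Defs.index A) : set (obj i) :=
  [set thread_component i (f s) | s in [set s | s \in S]].
Local Notation Y := component_image.

Lemma component_image_comm i (y z : obj i) : Y y -> Y z -> y * z = z * y.
Proof. by move=> [s sS <-] [t tS <-]; rewrite -!rmorphM Scomm. Qed.

Let component_bicommutant i (s : subring S) :
  thread_component i (f (val s)) \in hereditary_bicommutant Y (i := i).
Proof.
apply/hereditary_bicommutantP => k ki t tY; rewrite trans_thread.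
by rewrite tY //; exists (val s) => //; apply: valP.
Qed.

Let to_bicommutant (s : subring S) : prod_ring (@obj (bicommutant_system Y)) :=
  fun i => Sub (@thread_component A i (f (val s))) (component_bicommutant i s).

Let to_bicommutant_thread s : to_bicommutant s \in @thread (bicommutant_system Y).
Proof.
by apply/threadP => i j ij; apply: val_inj; apply: (trans_thread (f (val s)) ij).
Qed.

Let to_limit (s : subring S) : inverse_limit (bicommutant_system Y) :=
  Sub (to_bicommutant s) (to_bicommutant_thread s).

Fact to_limit_zmod_morphism : zmod_morphism to_limit.
Proof.
move=> s t; apply: (@thread_component_ext (bicommutant_system Y)) => i.
by apply: val_inj; rewrite /= !rmorphB.
Qed.

Fact to_limit_monoid_morphism : monoid_morphism to_limit.
Proof.
split=> [|s t]; apply: (@thread_component_ext (bicommutant_system Y)) => i.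
  by apply: val_inj; rewrite /= !rmorph1.
by apply: val_inj; rewrite /= !rmorphM.
Qed.

HB.instance Definition _ := GRing.isZmodMorphism.Build (subring S)
  (inverse_limit (bicommutant_system Y)) to_limit to_limit_zmod_morphism.
HB.instance Definition _ := GRing.isMonoidMorphism.Build (subring S)
  (inverse_limit (bicommutant_system Y)) to_limit to_limit_monoid_morphism.

(** A thread of bicommutants is a thread of A and comes from some r in R. For x in X, the components
    of x commute with the images of S, hence with those of r; so r is in S. *)
Lemma to_limit_bij :
  exists (h : {rmorphism subring S -> inverse_limit (bicommutant_system Y)}) h',
  cancel h h' /\ cancel h' h.
Proof.
have hI : injective to_limit.
  move=> s t st; apply: val_inj; apply: (can_inj fK).
  apply: thread_component_ext => i.
  exact: (congr1 (fun x => val (@thread_component (bicommutant_system Y) i x)) st).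
have hS y : exists s, to_limit s = y.
  pose w : prod_ring (@obj A) :=
    fun i => val (@thread_component (bicommutant_system Y) i y).
  have wT : w \in @thread A.
    apply/threadP => i j ij.
    exact: (congr1 val (@trans_thread (bicommutant_system Y) y i j ij)).
  pose r := g (Sub w wT).
  have fr i : thread_component i (f r) = w i by rewrite /r gK.
  have rS : r \in S.
    apply/SX => x Xx; apply: (can_inj fK); apply: thread_component_ext => i.
    rewrite !rmorphM /= fr.
    have /hereditary_bicommutantP :=
      valP (@thread_component (bicommutant_system Y) i y).
    move=> /(_ i (lexx i)) wY; have := wY (thread_component i (f x)).
    rewrite trans_id; apply=> _ [s sS <-].
    by rewrite -!rmorphM; congr (thread_component i (f _)); rewrite (SX s).1.
  exists (Sub r rS); apply: (@thread_component_ext (bicommutant_system Y)) => i.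
  by apply: val_inj; apply: fr.
pose h' y := sval (cid (hS y)).
have h'K : cancel h' to_limit by move=> y; apply: (svalP (cid (hS y))).
by exists to_limit, h'; split=> // s; apply: hI.
Qed.

End Pro.

(** The second conclusion provides the family from which [subring_semiperfect] obtains
    semiperfectness. *)
Lemma centralizer_pro Q (tau : topology_on R) : pro (satisfies_disc Q) tau ->
  (exists2 tauS : topology_on (subring S), linear_ring_topology tauS &
     pro (satisfies_disc Q) tauS) /\
  (exists2 B : set (set (subring S)), separating B & drazin_ring B).
Proof.
move=> [A AQ [f [g [fK gK _ _]]]].
have [h [h' [hK h'K]]] := to_limit_bij fK gK.
have YQ := bicommutant_system_disc (@component_image_comm A f) AQ.
split; first exact: iso_inverse_limit_pro YQ hK h'K.
exists (preim_ideals h (thread_kernels (A := _))).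
  exact: separating_preim (can_inj hK) (separating_thread_kernels _).
apply: (semicentral_drazin (bij_semicentral _ hK h'K)).
by apply: inverse_limit_drazin => i; apply: satisfies_disc_pi_regular (YQ i).
Qed.

(** Here S carries the subspace topology, with the contracted open ideals as basis. *)
Lemma centralizer_quasi (tau : topology_on R) :
  linear_ring_topology tau -> hausdorff_space (topologize tau) ->
  exists tauS : topology_on (subring S), exists B : set (set (subring S)),
    [/\ separating B, ideal_basis tauS B,
        quasi_pi_regular tau -> drazin_ring B &
        quasi_pi_inf_regular tau ->
          forall n, (0 < n)%N -> drazin_ring (mx_ideals n B)].
Proof.
move=> linR hR; have tauB := linear_ideal_basis linR.
have sepB := hausdorff_separating tauB hR.
have [_ [I0 BI0] dirB _] := tauB.
pose BS := preim_ideals incl (open_ideals tau).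
have sepBS : separating BS by apply: separating_preim sepB; apply: val_inj.
have BSN : exists I, BS I by exists (incl @^-1` I0); exists I0.
have dirBS I J : BS I -> BS J -> exists2 K, BS K & K `<=` I `&` J.
  move=> [I' BI <-] [J' BJ <-]; have [K BK KIJ] := dirB _ _ BI BJ.
  by exists (incl @^-1` K); [exists K | move=> x /KIJ].
have tauBS := ideal_topology_basis sepBS.1 BSN dirBS.
have inclC := centralizer_semicentral sepB.
exists (ideal_topology BSN dirBS), BS; split=> //.
  by move=> /(quasi_pi_regularP tauB)[_]; apply: semicentral_drazin.
move=> [_ _ qR] n /qR /(quasi_pi_regularP (ideal_basis_mx tauB n))[_ mxB].
have := semicentral_drazin (semicentral_mx n inclC) mxB.
apply: drazin_ring_sub => _ [_ [I BI <-] <-].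
exists (map_mx incl @^-1` [set M : 'M[R]_n | forall i j, I (M i j)]).
  by exists [set M : 'M[R]_n | forall i j, I (M i j)] => //; exists I.
by move=> M /= IM i j; have := IM i j; rewrite mxE.
Qed.

Lemma centralizer_satisfies P : satisfies P R -> satisfies P (subring S).
Proof.
have spS (B : set (set (subring S))) : separating B -> drazin_ring B ->
    semiperfect R -> semiperfect (subring S).
  by move=> sepB SB [slR _]; apply: (subring_semiperfect Scomm) sepB SB.
have quasi_inf (tau : topology_on R) :
    linear_ring_topology tau -> quasi_pi_inf_regular tau ->
    exists tauS : topology_on (subring S), exists B : set (set (subring S)),
      [/\ linear_ring_topology tauS,
          quasi_pi_inf_regular tauS, separating B & drazin_ring B].
  move=> linR qR; have [_ hR _] := qR.
  have [tauS [B [sepB tauSB _ /(_ qR) SB]]] := centralizer_quasi linR hR.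
  exists tauS, B; split=> //; [exact: ideal_basis_linear tauSB | split | ].
  - exact: ideal_basis_linear tauSB.
  - exact: ideal_basis_hausdorff tauSB sepB.
  - move=> n n0; apply/(quasi_pi_regularP (ideal_basis_mx tauSB n)).
    by split; [apply: separating_mx | apply: SB].
  - exact/drazin_ring_mx1/SB.
have quasi (tau : topology_on R) :
    linear_ring_topology tau -> quasi_pi_regular tau ->
    exists tauS : topology_on (subring S), exists B : set (set (subring S)),
      [/\ linear_ring_topology tauS,
          quasi_pi_regular tauS, separating B & drazin_ring B].
  move=> linR qR; have [_ hR _] := qR.
  have [tauS [B [sepB tauSB /(_ qR) SB _]]] := centralizer_quasi linR hR.
  exists tauS, B; split=> //; first exact: ideal_basis_linear tauSB.
  exact/(quasi_pi_regularP tauSB).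
case: P => [Q /=|[Q|Q||||] [tau linR /=]].
- apply: (subring_satisfies_disc Scomm (f := incl)).
  exact/centralizer_semicentral/separating_zero_ideal.
- by case/centralizer_pro.
- move=> [/centralizer_pro[[tauS linS QS] [B sepB SB]] spR].
  by exists tauS => //=; split=> //; apply: spS sepB SB spR.
- by move=> /(quasi_inf _ linR)[tauS [B [linS qS _ _]]]; exists tauS.
- move=> [/(quasi_inf _ linR)[tauS [B [linS qS sepB SB]]] spR].
  by exists tauS => //=; split=> //; apply: spS sepB SB spR.
- by move=> /(quasi _ linR)[tauS [B [linS qS _ _]]]; exists tauS.
- move=> [/(quasi _ linR)[tauS [B [linS qS sepB SB]]] spR].
  by exists tauS => //=; split=> //; apply: spS sepB SB spR.
Qed.

End Centralizer.

(** * Commutants and maximal commutative subrings *)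

Section Commutant.
Variable R : pzRingType.

Definition commutant (X : set R) : {pred R} :=
  fun r => `[< forall x, X x -> r * x = x * r >].

Lemma commutantP X r :
  reflect (forall x, X x -> r * x = x * r) (r \in commutant X).
Proof. exact: asboolP. Qed.

Fact commutant_subring_closed X : subring_closed (commutant X).
Proof.
split=> [|r s /commutantP rX /commutantP sX|r s /commutantP rX /commutantP sX];
  apply/commutantP => x Xx.
- by rewrite mul1r mulr1.
- by rewrite mulrBl mulrBr rX // sX.
- by rewrite -mulrA sX // !mulrA rX.
Qed.

HB.instance Definition _ X :=
  GRing.isSubringClosed.Build R (commutant X) (commutant_subring_closed X).

(** If r commutes with S, the double commutant [D] of S together with r is a commutative subring
    containing both, so r is in S by maximality. *)
Lemma maximal_commutative_commutant (S : subringClosed R) :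
  maximal_commutative_subring S ->
  forall r, (r \in S) <-> (forall x, [set` S] x -> r * x = x * r).
Proof.
move=> [Scomm Smax] r; split=> [rS x xS|rC]; first exact: Scomm.
pose X := [set` S] `|` [set r].
pose D := commutant [set` commutant X].
have XC x : X x -> x \in commutant X.
  move=> Xx; apply/commutantP => y Xy; case: Xx Xy => [xS|->] [yS|->] //.
  - exact: Scomm.
  - by rewrite rC.
  - exact: rC.
have DC x : x \in D -> x \in commutant X.
  move=> /commutantP xD; apply/commutantP => y Xy; apply: xD; exact: XC.
have XD x : X x -> x \in D.
  move=> Xx; apply/commutantP => y /commutantP yC; symmetry; exact: yC.
have Dcomm : commutative_subring D.
  by move=> x y /commutantP xD yD; apply: xD; apply: DC.
apply: (Smax _ Dcomm); last by apply: XD; right.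
by move=> x xS; apply: XD; left.
Qed.

End Commutant.

Theorem corollary7p2 (P : ring_property) (R : pzRingType)
    (RP : satisfies P R) :
  satisfies P (subring (center R)) /\
  (forall S : subringClosed R,
     maximal_commutative_subring S -> satisfies P (subring S)).
Proof.
split=> [|S maxS].
  (* The center is the centralizer of the whole ring. *)
  apply: (@centralizer_satisfies R (center R) setT) RP.
    by move=> x y /centerP xC _; apply: xC.
  move=> r; split=> [/centerP rC x _|rC]; first exact: rC.
  by apply/centerP => x; apply: rC.
apply: (centralizer_satisfies maxS.1 _ RP).
exact: maximal_commutative_commutant.
Qed.
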